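(* Let $\alpha=\frac1r$ with $r\ge 3$ a fixed integer, and let $D\subset\mathbb{R}^2$ be the set defined in the context. Let $k(x)=\left[\left|\frac1x\right|+1-\alpha\right]$ and $$\overline{T}_\alpha(x,y)=\left(T_\alpha(x),\ \frac{1}{k(x)+\operatorname{sign}(x)\,y}\right).$$ Then, up to sets of Lebesgue measure zero, $\overline{T}_\alpha:D\to D$ is well defined, one-to-one and onto, and it preserves the density $$K_\alpha(x,y)=\frac{1}{C_\alpha}\,\frac{1}{(xy+1)^2},\qquad C_\alpha=\int_D\frac{1}{(xy+1)^2}\,dx\,dy .$$ In other words, $\overline{T}_\alpha:D\to D$ is a natural extension for $T_\alpha$ (with factor map the projection $\pi_1(x,y)=x$, which satisfies $\pi_1\circ\overline{T}_\alpha=T_\alpha\circ\pi_1$).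
   Context: $[\cdot]$ denotes the integer part (floor). For $\alpha\in(0,1]$, $I_\alpha=[\alpha-1,\alpha]$ and $T_\alpha:I_\alpha\to I_\alpha$, $T_\alpha(x)=\left|\frac1x\right|-\left[\left|\frac1x\right|+1-\alpha\right]$ for $x\ne0$. Let $M_0:[0,1]\to[0,1]$, $M_0(x)=-\frac1x+\left[\frac1x+1\right]$ (the by-excess continued fraction map), and let $V_i(x)=\frac{1}{i-x}$, $i\in\{2,3,4,\dots\}$, be its inverse branches. A finite string $(2,\dots,2)$ of $s\ge1$ twos is treated as a single digit, denoted $(2)_s$ (so $(2)_1=2$), and $V_{(2)_s}=V_2\circ\cdots\circ V_2$ ($s$ times). Other digits are integers $\geq 3$; the condition ''$h\ge3$'' for a digit $h$ means that $h$ is such an integer and not a block of twos. Fix an integer $r\ge3$ and set $$\beta=\frac{r+1-\sqrt{(r+1)^2-4}}{2},\qquad \xi=\frac{1}{r-\beta}.$$ For $n\ge1$ let $H_n^+$, $H_n^-$ and $H_n^i$ ($i=2,\dots,r-1$) be the sets of sequences $(h_1,\dots,h_n)$ of digits such that $h_2,\dots,h_n\in\{(2)_1,\dots,(2)_{r-2}\}\cup\{3,4,\dots,r+1\}$, such that $h_j=(2)_s$ implies $h_{j+1}\ge3$ (for $j<n$), and such that: - for $H_n^+$: $h_1\in\{(2)_1,\dots,(2)_{r-1}\}\cup\{3,\dots,r\}$; - for $H_n^-$: $h_1\in\{(2)_1,\dots,(2)_{r-2}\}\cup\{3,\dots,r+1\}$; - for $H_n^i$: $h_1\in\{(2)_1,\dots,(2)_{r-1-i}\}\cup\{3,\dots,r+1\}$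 (no blocks of twos allowed for $h_1$ if $r-1-i=0$). Let $\hat H_n^+,\hat H_n^-,\hat H_n^i$ be the subsets of those sequences with $h_n\ge3$. For each symbol $*\in\{+,-,2,3,\dots,r-1\}$ put $$B^*=\bigcup_{n=1}^\infty\ \bigcup_{(h_1,\dots,h_n)\in\hat H_n^*}(V_{h_1}\circ V_{h_2}\circ\cdots\circ V_{h_n})\big((1-\xi,1)\big).$$ Finally let $$E=\bigcup_{i=1}^{r-1}\left(\left[-\tfrac{i}{i+1},-\tfrac{i-1}{i}\right]\times\left[0,M_0^{i-1}(1-\xi)\right]\right)\cup\left(\left[0,\tfrac1r\right]\times[0,1-\beta]\right),$$ $$B=\bigcup_{i=2}^{r-1}\left(\left[-\tfrac{i}{i+1},-\tfrac{i-1}{i}\right]\times B^i\right)\cup\left(\left[-\tfrac12,0\right]\times B^-\right)\cup\left(\left[0,\tfrac1r\right]\times B^+\right),$$ $$D=E\setminus B.$$ *)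

(* Defs.v *)
From HB Require Import structures.
From mathcomp Require Import all_boot all_order all_algebra.
From mathcomp Require Import all_classical all_reals all_analysis.

Import Order.TTheory GRing.Theory Num.Theory.
Import numFieldNormedType.Exports.

Local Open Scope classical_set_scope.
Local Open Scope ring_scope.

(* Since 0^-1 = 0, the maps below are total; their values at 0 are junk. *)

Definition k_ {R : realType} (alpha x : R) : int :=
  Num.floor (`|x^-1| + 1 - alpha).

Definition T_ {R : realType} (alpha x : R) : R :=
  `|x^-1| - (k_ alpha x)%:~R.

Definition Ialpha {R : realType} (alpha : R) : set R := `[alpha - 1, alpha].

Definition Tbar {R : realType} (alpha : R) (p : R * R) : R * R :=
  (T_ alpha p.1, ((k_ alpha p.1)%:~R + Num.sg p.1 * p.2)^-1).

Definition M0 {R : realType} (x : R) : R :=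
  - x^-1 + (Num.floor (x^-1 + 1))%:~R.

Definition V {R : realType} (i : nat) (x : R) : R := (i%:R - x)^-1.

(* [Twos s] is the block (2)_s, [Big h] the integer digit h; the bounds
   1 <= s and 3 <= h are imposed by [digit_in]. *)
Inductive digit := Twos of nat | Big of nat.

Definition is_big (d : digit) : bool := if d is Big _ then true else false.

Definition Vdigit {R : realType} (d : digit) : R -> R :=
  match d with Twos s => iter s (V 2) | Big h => V h end.

Definition Vword {R : realType} (h : seq digit) (x : R) : R :=
  foldr Vdigit x h.

(* membership in {(2)_1, ..., (2)_m} \cup {3, ..., M} *)
Definition digit_in (m M : nat) (d : digit) : bool :=
  match d with Twos s => (1 <= s <= m)%N | Big h => (3 <= h <= M)%N end.

Inductive symbol := Plus | Minus | Idx of nat.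

Definition first_digit (r : nat) (s : symbol) : digit -> bool :=
  match s with
  | Plus => digit_in (r - 1) r
  | Minus => digit_in (r - 2) r.+1
  | Idx i => digit_in (r - 1 - i) r.+1
  end.

Definition admissible (d d' : digit) : bool := ~~ is_big d ==> is_big d'.

Definition H (r : nat) (s : symbol) (n : nat) : set (seq digit) :=
  [set h | if h is h1 :: t then
     [/\ size h = n, first_digit r s h1, all (digit_in (r - 2) r.+1) t
       & path admissible h1 t]
   else False].

Definition Hhat (r : nat) (s : symbol) (n : nat) : set (seq digit) :=
  [set h | H r s n h /\ is_big (last (Twos 1) h)].

Definition beta (R : realType) (r : nat) : R :=
  (r%:R + 1 - Num.sqrt ((r%:R + 1) ^+ 2 - 4)) / 2.

Definition xi (R : realType) (r : nat) : R := (r%:R - beta R r)^-1.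

Definition Bsym (R : realType) (r : nat) (s : symbol) : set R :=
  \bigcup_(n in [set n | (1 <= n)%N]) \bigcup_(h in Hhat r s n)
    (Vword h @` `]1 - xi R r, 1[).

Definition strip (R : realType) (i : nat) : set R :=
  `[- (i%:R / (i%:R + 1)), - ((i%:R - 1) / i%:R)].

Definition E (R : realType) (r : nat) : set (R * R) :=
  (\bigcup_(i in [set i | (1 <= i <= r - 1)%N])
     (strip R i `*` `[0, iter (i - 1) M0 (1 - xi R r)]))
  `|` (`[0, r%:R^-1] `*` `[0, 1 - beta R r]).

Definition B (R : realType) (r : nat) : set (R * R) :=
  (\bigcup_(i in [set i | (2 <= i <= r - 1)%N])
     (strip R i `*` Bsym R r (Idx i)))
  `|` (`[- (1 / 2), 0] `*` Bsym R r Minus)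
  `|` (`[0, r%:R^-1] `*` Bsym R r Plus).

Definition D (R : realType) (r : nat) : set (R * R) := E R r `\` B R r.

Definition plane (R : realType) := (measurableTypeR R * measurableTypeR R)%type.

Definition lebesgue2 (R : realType) : {measure set (plane R) -> \bar R} :=
  (@lebesgue_measure R \x @lebesgue_measure R)%E.

Definition Calpha (R : realType) (r : nat) : \bar R :=
  (\int[lebesgue2 R]_(p in D R r) (((p.1 * p.2 + 1) ^+ 2)^-1)%:E)%E.

Definition Kalpha {R : realType} (r : nat) (p : R * R) : R :=
  (fine (Calpha R r))^-1 * ((p.1 * p.2 + 1) ^+ 2)^-1.

Definition measure_preserving {d : measure_display} {X : measurableType d}
    {R : realType}
    (mu : probability X R) (f : X -> X) : Prop :=
  measurable_fun setT f /\
  forall A, measurable A -> mu (f @^-1` A) = mu A.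

(* Rohlin's notion: (Y, nu, S) is invertible modulo a null set, pi is a factor
   map onto (X, mu, T), and the sigma-algebra of Y is, modulo null sets, the
   smallest one containing S^n (pi^-1 F) for all measurable F and n >= 0. *)
Definition natural_extension {dX dY : measure_display}
    {X : measurableType dX} {Y : measurableType dY} {R : realType}
    (mu : probability X R) (T : X -> X)
    (nu : probability Y R) (S : Y -> Y) (pi : Y -> X) : Prop :=
  [/\ measure_preserving mu T,
      measure_preserving nu S,
      measurable_fun setT pi /\
        (forall A, measurable A -> mu A = nu (pi @^-1` A)) &
      exists Y0 : set Y,
        [/\ measurable Y0 /\ nu Y0 = 1%E,
            set_bij Y0 Y0 S,
            forall A, measurable A -> A `<=` Y0 -> measurable (S @` A),
            forall y, Y0 y -> pi (S y) = T (pi y) &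
            forall A, measurable A -> exists2 A',
              <<s Y0, [set G | exists n F, measurable F /\
                         G = iter n S @` (Y0 `&` pi @^-1` F)] >> A' &
              nu.-negligible (A `+` A')]].

(* Main.v *)
Require Import Defs.
From HB Require Import structures.
From mathcomp Require Import all_boot all_order all_algebra.
From mathcomp Require Import all_classical all_reals all_analysis.
From mathcomp Require Import measurable_realfun ring lra zify.

Import Order.TTheory GRing.Theory Num.Theory.
Import numFieldNormedType.Exports.

Set Implicit Arguments.
Unset Strict Implicit.
Unset Printing Implicit Defensive.

Local Open Scope classical_set_scope.
Local Open Scope ring_scope.

(** Over an irrational x the fiber of D depends only on the strip containing x:
    it is F_+ if x > 0 and some F_i if x < 0. On each branch Tbar is a product of
    two Moebius maps that preserves dx dy / (1 + xy)^2, so everything reduces to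
    showing that the images of the branches tile D up to a null set. A point
    (x', 1/(k + v)), with k >= 1 and 0 < v < 1, has two candidate preimages, one
    with positive and one with negative first coordinate, and in the critical
    case these lie in D iff v \in F_+, resp. 1 - v \in F_1. Hence the tiling
    amounts to the statement that F_+ and 1 - F_1 are complementary in [0, 1] up
    to a null set. Writing v = 1/(k + v'), the digit rules give v \in F_+ iff
    k >= r or 1 - v' \in F_1, and 1 - v \in F_1 iff k < r and v' \in F_+; thus
    complementarity can fail at v only if k < r and it fails at v' too, so the
    failures have all their partial quotients below r and form a null set.
    The exceptional null sets are then saturated under Tbar. Finally, the second
    coordinate of a point is the value of a continued fraction read off from the
    first coordinates of its past, which gives the generation property. *)

(** * Change of variables *)

(** The fibers of [D] are coded by by-excess digits, the map by regular partial quotients. The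
    dictionary is [1/(k + v) = V_{k+1}(1 - v)] and [1 - 1/(k + 1 + v) = V_2^k(1 - 1/(1 + v))]:
    quotients turn alternately into a digit and into the length of a possibly empty block of twos,
    which matches treating [(2)_s] as one digit and forbidding two adjacent blocks. The constants
    [beta] and [xi] make cut and holes fit: the seed [(1 - xi, 1)] of the holes is exactly what
    [[0, 1 - xi]] misses in [(0, 1)], so after a digit the cut and the removal of holes merge into a
    single condition on the tail. The tiling is studied at irrational coordinates only, so that end
    points of strips and cylinders never have to be treated. That the image of the good points fills
    [D] up to a null set is not checked on second coordinates: it follows from the invariance of a
    finite measure. *)

Section WeightedPushforward.
Context d d' (X : measurableType d) (Y : measurableType d') (R : realType).
Variables (mu : {measure set X -> \bar R}) (phi : X -> Y) (f : X -> R).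
Hypotheses (mphi : measurable_fun setT phi).
Hypotheses (mf : measurable_fun setT f) (f0 : forall x, 0 <= f x).

(** One construction serves for the auxiliary measures below: with [phi] the identity it has density
    [f], with [phi] a projection it is a marginal. The proofs are arguments so that the measure
    structure can be attached to the constant. *)
Definition weighted_pushforward of measurable_fun setT phi &
    measurable_fun setT f & (forall x, 0 <= f x) :=
  fun A : set Y => (\int[mu]_(x in phi @^-1` A) (f x)%:E)%E.

Local Notation nu := (weighted_pushforward mphi mf f0).

Let mpre A : measurable A -> measurable (phi @^-1` A).
Proof. by move=> mA; rewrite -(setTI (_ @^-1` _)); exact: mphi. Qed.

Let nu0 : nu set0 = 0%E.
Proof. by rewrite /weighted_pushforward preimage_set0 integral_set0. Qed.

Let nu_ge0 A : (0 <= nu A)%E.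
Proof. by apply: integral_ge0 => x _; rewrite lee_fin. Qed.

Let nu_semi_sigma_additive : semi_sigma_additive nu.
Proof.
move=> F mF tF mUF; rewrite /weighted_pushforward preimage_bigcup.
rewrite ge0_integral_bigcup//.
- by apply: is_cvg_ereal_nneg_natsum_cond => n _ _; exact: nu_ge0.
- by move=> n; exact: mpre.
- exact/measurable_EFinP/measurable_funTS.
- by move=> x _; rewrite lee_fin.
- apply/trivIsetP => /= i j _ _ ij; rewrite -preimage_setI.
  by move/trivIsetP : tF => /(_ _ _ _ _ ij) ->//; rewrite preimage_set0.
Qed.

HB.instance Definition _ :=
  isMeasure.Build _ _ _ nu nu0 nu_ge0 nu_semi_sigma_additive.

Import HBNNSimple.

Lemma ge0_integral_weighted_pushforward (g : Y -> \bar R) :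
  measurable_fun setT g -> (forall y, (0 <= g y)%E) ->
  (\int[nu]_y g y = \int[mu]_x (g (phi x) * (f x)%:E))%E.
Proof.
move=> mg g0; pose g_ := nnsfun_approx measurableT mg.
transitivity (limn (fun n => \int[nu]_y (g_ n y)%:E))%E.
  rewrite -monotone_convergence//.
  - apply: eq_integral => y _; apply/esym/cvg_lim => //.
    exact: cvg_nnsfun_approx.
  - by move=> n; exact/measurable_EFinP/measurable_funTS.
  - by move=> n x _; rewrite lee_fin.
  - by move=> x _ m n mn; rewrite lee_fin; exact/lefP/nd_nnsfun_approx.
have mg_ n : measurable_fun setT (fun x => g_ n (phi x)).
  by apply: measurableT_comp => //; exact: measurable_funP.
transitivity (limn (fun n => \int[mu]_x ((g_ n (phi x))%:E * (f x)%:E)))%E;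
    last first.
  rewrite -monotone_convergence//; last 3 first.
  - move=> n; apply: emeasurable_funM => //; first exact/measurable_EFinP.
    exact/measurable_EFinP.
  - by move=> n x _; rewrite mule_ge0// lee_fin.
  - move=> x _ m n mn; rewrite lee_wpmul2r ?lee_fin//.
    exact/lefP/nd_nnsfun_approx.
  apply: eq_integral => x _; apply/cvg_lim => //.
  by apply: cvgeZr => //; apply: cvg_nnsfun_approx.
congr (limn _); apply/funext => n.
transitivity (\int[nu]_y
   (\sum_(r \in range (g_ n)) (r * \1_(g_ n @^-1` [set r]) y)%:E))%E.
  by apply: eq_integral => t _; rewrite /= fimfunE -fsumEFin.
have indich r : measurable_fun setT (fun y => (r * \1_(g_ n @^-1` [set r]) y)%:E).
  by apply/measurable_EFinP; exact: measurable_funM.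
have mindic r : measurable_fun setT
    (fun x => (\1_(g_ n @^-1` [set r]) (phi x) : R)).
  by apply: (measurableT_comp _ mphi); exact: measurable_indic.
rewrite ge0_integral_fsum//; last by move=> m y _; exact: nnfun_muleindic_ge0.
transitivity (\int[mu]_x (\sum_(r \in range (g_ n))
    (r * \1_(g_ n @^-1` [set r]) (phi x))%:E * (f x)%:E))%E; last first.
  apply: eq_integral => x _.
  rewrite -ge0_mule_fsuml => [|y]; last exact: nnfun_muleindic_ge0.
  by rewrite fsumEFin// -(fimfunE _ (phi x)).
rewrite ge0_integral_fsum//; last 2 first.
- move=> r; apply: emeasurable_funM; last exact/measurable_EFinP.
  exact/measurable_EFinP/measurable_funM.
- by move=> m y _; apply: mule_ge0; [exact: nnfun_muleindic_ge0|rewrite lee_fin].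
apply: eq_fsbigr => r rhn.
under eq_integral do rewrite EFinM.
rewrite integralZl_indic_nnsfun//.
under [RHS]eq_integral do rewrite EFinM -muleA.
rewrite ge0_integralZl//.
- under [in RHS]eq_integral do rewrite muleC.
  rewrite [in RHS](eq_integral ((EFin \o f) \_ (phi @^-1` (g_ n @^-1` [set r])))).
    by rewrite -integral_mkcond integral_indic// setIT.
  by move=> x xE; rewrite epatch_indic.
- apply: emeasurable_funM; exact/measurable_EFinP.
- by move=> t Et; rewrite mule_ge0 ?lee_fin.
- by move: rhn; rewrite inE => -[t _ <-]; rewrite lee_fin.
Qed.

End WeightedPushforward.

Section Inversion.
Context {R : realType}.
Local Notation mu := (@lebesgue_measure R).

Lemma measurable_inv : measurable_fun setT (@GRing.inv R).
Proof.
have m0 : measurable [set (0 : R)] by exact: measurable_set1.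
rewrite -(setvU [set (0 : R)]); apply/measurable_funU => //.
  exact: measurableC.
split; last first.
  have : measurable_fun [set (0:R)] (cst 0 : R -> R) by [].
  by apply: eq_measurable_fun => x /[!inE] /= ->; rewrite invr0.
apply: open_continuous_measurable_fun.
  by apply: closed_openC; exact: closed_eq.
move=> x /[!inE] /= /eqP x0; exact: inv_continuous.
Qed.

Lemma measurable_inv2 : measurable_fun setT (fun y : R => y^-1 ^+ 2).
Proof. exact: (measurable_funX 2 measurable_inv). Qed.


Lemma is_derive_oppinv (x : R) : 0 < x ->
  is_derive x 1 (fun y : R => - y^-1) (x^-1 ^+ 2).
Proof.
move=> x0; have x0' : x != 0 by rewrite gt_eqF.
have dV := @is_deriveV R id x 1 1 x0' (is_derive_id _ _).
have /is_derive_eq := @is_deriveN _ _ _ _ _ _ _ dV; apply.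
by rewrite -exprVn scaleNr opprK /GRing.scale/= mulr1.
Qed.

Lemma integral_inv2_itvy (a : R) : 0 < a ->
  (\int[mu]_(y in `[a, +oo[) ((y^-1 ^+ 2)%:E) = (a^-1)%:E)%E.
Proof.
move=> a0.
have cV (x : R) : a <= x -> {for x, continuous (@GRing.inv R)}.
  by move=> ax; apply: inv_continuous; rewrite gt_eqF// (lt_le_trans a0).
rewrite (@ge0_continuous_FTC2y _ _ (fun y : R => - y^-1) a 0)//.
- by rewrite sub0e -EFinN opprK.
- by move=> x _; rewrite sqr_ge0.
- apply: continuous_in_subspaceT => x /[!inE]; rewrite /= in_itv/= andbT => ax.
  apply: (@continuous_comp _ _ _ (@GRing.inv R) (fun y : R => y ^+ 2)).
    exact: cV.
  exact: exprn_continuous.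
- rewrite -oppr0; apply: cvgN; apply/gtr0_cvgV0; last exact: cvg_id.
  exact: nbhs_pinfty_gt.
- by move=> x ax; have [] := is_derive_oppinv (lt_trans a0 ax).
- apply: cvgN; apply: cvg_at_right_filter; exact: cV.
- move=> x; rewrite in_itv/= andbT => ax; rewrite derive1E.
  exact: (@derive_val _ _ _ _ _ _ _ (is_derive_oppinv (lt_trans a0 ax))).
Qed.

Lemma ge0_integral_bndc_add_bndy (f : R -> R) (a b : R) : a <= b ->
  measurable_fun setT f -> (forall x, 0 <= f x) ->
  (\int[mu]_(y in `[a, +oo[) (f y)%:E =
   \int[mu]_(y in `[a, b[) (f y)%:E + \int[mu]_(y in `[b, +oo[) (f y)%:E)%E.
Proof.
move=> ab mf f0; rewrite -ge0_integral_setU//=.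
- congr integral; apply/seteqP; split=> x; rewrite /setU/= !in_itv/= !andbT.
    by move=> ->/=; case: ltP; [left|right].
  by move=> [/andP[]//|]; exact: le_trans.
- exact/measurable_EFinP/measurable_funTS.
- by move=> x _; rewrite lee_fin.
- rewrite disj_set2E; apply/eqP/seteqP; split=> x //=.
  by rewrite !in_itv/= andbT => -[/andP[_ xb] /(lt_le_trans xb)]; rewrite ltxx.
Qed.

Let w0 (y : R) : 0 <= y^-1 ^+ 2. Proof. exact: sqr_ge0. Qed.

Let inv_ : measurableTypeR R -> measurableTypeR R := @GRing.inv R.

(** The image under inversion of the measure with density [1/y^2]. That it agrees with Lebesgue
    measure on the positive half-line is the substitution [y -> 1/y]. *)
Let m : {measure set (measurableTypeR R) -> \bar R} :=
  weighted_pushforward mu (measurable_inv : measurable_fun setT inv_)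
    measurable_inv2 w0.

Let m_itvoc (c d : R) : 0 <= c -> c < d -> m `]c, d]%classic = (d - c)%:E.
Proof.
move=> c0 cd; have d0 : 0 < d by exact: le_lt_trans cd.
move: c0; rewrite le_eqVlt => /predU1P[c0|c0].
  rewrite -c0 subr0 -[d in RHS]invrK -integral_inv2_itvy ?invr_gt0//.
  congr integral; apply/seteqP; split=> x; rewrite /=!in_itv/= andbT.
    by rewrite invr_gt0 => /andP[x0]; rewrite invf_ple.
  move=> dx; have x0 : 0 < x by apply: lt_le_trans dx; rewrite invr_gt0.
  by rewrite invr_gt0 x0/= invf_ple.
have := @ge0_integral_bndc_add_bndy (fun y => y^-1 ^+ 2) d^-1 c^-1.
rewrite !integral_inv2_itvy ?invr_gt0// !invrK lef_pV2// => /(_ (ltW cd)).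
move=> /(_ measurable_inv2 w0) dE.
have -> : m `]c, d]%classic = (\int[mu]_(y in `[(d^-1)%R, (c^-1)%R[) (y^-1 ^+ 2)%:E)%E.
  congr integral; apply/seteqP; split=> x; rewrite /=!in_itv/=.
    move=> /andP[cx xd]; have x0 : 0 < x by rewrite -invr_gt0 (lt_trans c0).
    by rewrite invf_ple// xd/= invf_pgt.
  move=> /andP[dx xc]; have x0 : 0 < x by apply: lt_le_trans dx; rewrite invr_gt0.
  by rewrite invf_pgt// xc/= invf_ple.
by rewrite EFinB dE addeK.
Qed.

Let m_pos (A : set (measurableTypeR R)) : measurable A ->
  mu (A `&` `]0%R, +oo[%classic) = m (A `&` `]0%R, +oo[%classic).
Proof.
have mp : measurable (`]0, +oo[%classic : set R) by exact: measurable_itv.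
move=> mA; apply: (@measure_unique _ R (measurableTypeR R) (@ocitv R)
  (fun n => `]-n%:R, n%:R]%classic) _ _ _ _ (mrestr mu mp) (mrestr m mp)) => //.
- exact: ocitvI.
- by move=> n; exact: is_ocitv.
- exact: bigcup_itvT.
- move=> _ [[a b]] _ <-; rewrite /= /mrestr -/m.
  have [ab|ba] := ltP (Num.max a 0) b.
    rewrite (_ : _ `&` _ = `](Num.max a 0), b]%classic); last first.
      apply/seteqP; split=> x /=; rewrite !in_itv/= andbT gt_max.
        by move=> [/andP[-> ->] ->].
      by move=> /andP[/andP[-> ->] ->].
    by rewrite lebesgue_measure_itv/= lte_fin ab m_itvoc ?le_max ?lexx ?orbT// EFinB.
  rewrite (_ : _ `&` _ = set0); last first.
    apply/seteqP; split=> x //=; rewrite !in_itv/= andbT => -[/andP[ax xb] x0].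
    have : Num.max a 0 < x by rewrite gt_max ax.
    by move=> /lt_le_trans/(_ (le_trans xb ba)); rewrite ltxx.
  by rewrite !measure0.
- move=> k; rewrite /= /mrestr; apply: (@le_lt_trans _ _ (mu `]-k%:R, k%:R]%classic)).
    by apply: le_measure; rewrite ?inE//; exact: measurableI.
  by rewrite lebesgue_measure_itv/=; case: ifP => // _; rewrite -EFinB ltry.
Qed.

Let inv_pos (f : R -> \bar R) : measurable_fun setT f ->
  (forall y, (0 <= f y)%E) ->
  (\int[mu]_(y in `]0%R, +oo[) f y =
   \int[mu]_(y in `]0%R, +oo[) (f (y^-1)%R * (y^-1 ^+ 2)%:E))%E.
Proof.
move=> mf f0.
have mp : measurable (`]0, +oo[%classic : set R) by exact: measurable_itv.
rewrite (eq_measure_integral m); last first.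
  by move=> A mA Apos; rewrite -(setIidl Apos); exact: m_pos.
rewrite integral_mkcond ge0_integral_weighted_pushforward//; last 2 first.
- exact: (measurable_restrictT f mp).1 (measurable_funTS mf).
- by move=> y; exact: erestrict_ge0.
rewrite [RHS]integral_mkcond; apply: eq_integral => y _.
rewrite /restrict !mem_setE !in_itv/= !andbT invr_gt0.
by case: ifP; rewrite ?mul0e.
Qed.

Lemma ge0_integral_opp (f : R -> \bar R) : measurable_fun setT f ->
  (forall y, (0 <= f y)%E) -> (\int[mu]_y f y = \int[mu]_y f (- y)%R)%E.
Proof.
move=> mf f0; have mN : measurable_fun setT
  (-%R : measurableTypeR R -> measurableTypeR R) by exact: oppr_measurable.
transitivity (\int[pushforward mu (-%R : _ -> measurableTypeR R)]_y f y)%E.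
  by apply: eq_measure_integral => //= A mA _; exact/esym/lebesgue_measureN.
by rewrite ge0_integral_pushforward.
Qed.

Lemma lebesgue_measure_shift (c : R) (A : set R) : measurable A ->
  pushforward mu ((fun x => x + c)%R : _ -> measurableTypeR R) A = mu A.
Proof.
move=> mA; apply/esym/lebesgue_measure_unique => //=.
  exact: measurable_funD.
move=> _ _ [[a b]] _ <-; rewrite /pushforward.
have -> : (fun x => x + c) @^-1` `]a, b]%classic = `]a - c, b - c]%classic.
  by apply/seteqP; split=> x/=; rewrite !in_itv/= ltrBlDr lerBrDr.
rewrite !lebesgue_measure_itv/= !lte_fin ltrD2r; case: ifP => // _.
by rewrite -!EFinB; congr EFin; ring.
Qed.

Lemma ge0_integral_shift (c : R) (f : R -> \bar R) : measurable_fun setT f ->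
  (forall y, (0 <= f y)%E) -> (\int[mu]_y f y = \int[mu]_y f (y + c)%R)%E.
Proof.
move=> mf f0; have mN : measurable_fun setT
  ((fun x => x + c) : measurableTypeR R -> measurableTypeR R).
  exact: measurable_funD.
transitivity (\int[pushforward mu ((fun x => x + c)%R : _ -> measurableTypeR R)]_y f y)%E.
  by apply: eq_measure_integral => //= A mA _; exact/esym/lebesgue_measure_shift.
by rewrite ge0_integral_pushforward.
Qed.

Let split_pos (f : R -> \bar R) : measurable_fun setT f ->
  (forall y, (0 <= f y)%E) ->
  (\int[mu]_y f y = \int[mu]_(y in `]0%R, +oo[) (f y + f (- y)%R))%E.
Proof.
move=> mf f0; have mfN : measurable_fun setT (fun y : R => f (- y)%R).
  by apply: measurableT_comp.
rewrite ge0_integralD//; [|exact: measurable_funTS|exact: measurable_funTS].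
rewrite !integral_itv_obnd_cbnd; [|exact: measurable_funTS|exact: measurable_funTS].
rewrite (ge0_integration_by_substitution0 mfN)//.
under [X in (_ + X)%E]eq_integral do rewrite opprK.
rewrite -integral_itv_bndo_bndc; last exact: measurable_funTS.
rewrite -ge0_integral_setU//=.
- congr integral; apply/seteqP; split=> x //= _.
  by rewrite !in_itv/= andbT; case: leP => _; [left|right].
- exact: measurable_funTS.
- rewrite disj_set2E; apply/eqP/seteqP; split=> x //=.
  by rewrite !in_itv/= andbT => -[/le_lt_trans h /h]; rewrite ltxx.
Qed.

(** Inversion preserves each half-line and commutes with negation, so folding the line onto the
    positive half-line reduces this to [inv_pos]; the point 0 is negligible. *)
Lemma ge0_integral_inv (f : R -> \bar R) : measurable_fun setT f ->
  (forall y, (0 <= f y)%E) ->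
  (\int[mu]_y f y = \int[mu]_y (f (y^-1)%R * (y^-1 ^+ 2)%:E))%E.
Proof.
move=> mf f0; rewrite split_pos// inv_pos; last 2 first.
- by apply: emeasurable_funD => //; apply: measurableT_comp.
- by move=> y; rewrite adde_ge0.
rewrite [RHS]split_pos//; last 2 first.
- apply: emeasurable_funM; first exact: (measurableT_comp mf measurable_inv).
  by apply/measurable_EFinP; exact: measurable_inv2.
- by move=> y; rewrite mule_ge0 ?lee_fin.
by apply: eq_integral => y _; rewrite ge0_muleDl// invrN sqrrN.
Qed.

End Inversion.

Section Branches.
Context {R : realType}.
Local Notation mu := (@lebesgue_measure R).

(* For a sign [s], Tbar coincides with [branch s k] where k_ = k and sg x = s.
   Since 0^-1 = 0 this is a bijection of the whole plane, poles included, which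
   is why the changes of variables below need no domain. *)
Definition branch (s k : R) (p : R * R) : R * R :=
  (s * p.1^-1 - k, (k + s * p.2)^-1).

Definition branch_inv (s k : R) (p : R * R) : R * R :=
  (s * (p.1 + k)^-1, s * (p.2^-1 - k)).

Lemma branchK (s k : R) : `|s| = 1 -> cancel (branch s k) (branch_inv s k).
Proof.
move=> s1 [x y]; have ss : s * s = 1 by rewrite -expr2 -real_normK ?num_real// s1 expr1n.
have sV : s^-1 = s by apply: (mulfI (x := s)); rewrite ?ss ?divff// -normr_gt0 s1.
rewrite /branch /branch_inv /= subrK invrK [k + _]addrC addrK !mulrA ss mul1r.
by rewrite invfM invrK sV mulrA ss mul1r.
Qed.

Lemma branch_invK (s k : R) : `|s| = 1 -> cancel (branch_inv s k) (branch s k).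
Proof.
move=> s1 [x y]; have ss : s * s = 1 by rewrite -expr2 -real_normK ?num_real// s1 expr1n.
have sV : s^-1 = s by apply: (mulfI (x := s)); rewrite ?ss ?divff// -normr_gt0 s1.
rewrite /branch /branch_inv /= invfM invrK sV !mulrA ss !mul1r addrK.
by rewrite addrC subrK invrK.
Qed.

Lemma image_branch (s k : R) (A : set (plane R)) : `|s| = 1 ->
  branch s k @` A = branch_inv s k @^-1` A.
Proof.
move=> s1; apply/seteqP; split=> [_ [p Ap <-]|p Ap]; rewrite /= ?branchK//.
by exists (branch_inv s k p) => //; rewrite branch_invK.
Qed.

Lemma measurable_fst_plane : measurable_fun setT (fun p : plane R => p.1 : R).
Proof. exact: measurable_fst. Qed.

Lemma measurable_snd_plane : measurable_fun setT (fun p : plane R => p.2 : R).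
Proof. exact: measurable_snd. Qed.

Lemma measurable_pair_plane d (T : measurableType d) (f g : T -> R) :
  measurable_fun setT f -> measurable_fun setT g ->
  measurable_fun setT (fun t => (f t, g t) : plane R).
Proof.
exact: (@measurable_fun_pair _ _ _ T (measurableTypeR R) (measurableTypeR R)).
Qed.

Lemma measurable_branch (s k : R) : measurable_fun setT (branch s k : plane R -> plane R).
Proof.
rewrite /branch; apply: measurable_pair_plane.
  apply: measurable_funB => //; apply: measurable_funM => //.
  exact: (measurableT_comp measurable_inv measurable_fst_plane).
apply: (measurableT_comp measurable_inv); apply: measurable_funD => //.
by apply: measurable_funM => //; exact: measurable_snd_plane.
Qed.

Lemma measurable_branch_inv (s k : R) : measurable_fun setT (branch_inv s k : plane R -> plane R).
Proof.
rewrite /branch_inv; apply: measurable_pair_plane; apply: measurable_funM => //.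
  by apply: (measurableT_comp measurable_inv); apply: measurable_funD.
apply: measurable_funB => //.
exact: (measurableT_comp measurable_inv measurable_snd_plane).
Qed.

Lemma ge0_integral_sign (s : R) (f : R -> \bar R) : `|s| = 1 ->
  measurable_fun setT f -> (forall y, (0 <= f y)%E) ->
  (\int[mu]_y f y = \int[mu]_y f (s * y)%R)%E.
Proof.
move=> s1 mf f0; have [s0|s0] := leP 0 s.
  rewrite -(ger0_norm s0) s1.
  by apply: eq_integral => y _; rewrite mul1r.
rewrite ge0_integral_opp//; apply: eq_integral => y _.
by rewrite -(opprK s) -(ltr0_norm s0) s1 mulN1r.
Qed.

Lemma ge0_integral_moebius (s k : R) (f : R -> \bar R) : `|s| = 1 ->
  measurable_fun setT f -> (forall y, (0 <= f y)%E) ->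
  (\int[mu]_y f y =
   \int[mu]_y (f (k + s * y)^-1%R * ((k + s * y)^-1 ^+ 2)%:E))%E.
Proof.
move=> s1 mf f0; rewrite ge0_integral_inv//.
have mg : measurable_fun setT (fun y : R => (f y^-1%R * (y^-1 ^+ 2)%:E)%E).
  apply: emeasurable_funM; first exact: (measurableT_comp mf measurable_inv).
  by apply/measurable_EFinP; exact: measurable_inv2.
have g0 y : (0 <= f y^-1%R * (y^-1 ^+ 2)%:E)%E.
  by rewrite mule_ge0// lee_fin sqr_ge0.
rewrite (ge0_integral_shift k mg g0).
rewrite (ge0_integral_sign (f := fun y => f (y + k)^-1%R * _)%E s1)//.
  by apply: eq_integral => y _; rewrite addrC.
apply: (measurableT_comp mg); exact: measurable_funD.
Qed.

Lemma ge0_integral_inv_shift (s k : R) (f : R -> \bar R) : `|s| = 1 ->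
  measurable_fun setT f -> (forall y, (0 <= f y)%E) ->
  (\int[mu]_x f x = \int[mu]_x (f (s * x^-1 - k)%R * (x^-1 ^+ 2)%:E))%E.
Proof.
move=> s1 mf f0; rewrite (ge0_integral_shift (- k))//.
have mfk : measurable_fun setT (fun x : R => f (x - k)).
  by apply: (measurableT_comp mf); exact: measurable_funB.
rewrite (ge0_integral_sign (f := fun x => f (x - k)) s1)//.
rewrite ge0_integral_inv//; apply: (measurableT_comp mfk).
exact: measurable_funM.
Qed.

(** A branch acts on each coordinate separately, so Tonelli and the two one-dimensional
    substitutions replace a Jacobian in the plane. *)
Lemma ge0_integral_branch (s k : R) (f : plane R -> \bar R) : `|s| = 1 ->
  measurable_fun setT f -> (forall p, (0 <= f p)%E) ->
  (\int[lebesgue2 R]_p f p = \int[lebesgue2 R]_p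
     (f (branch s k p) * (p.1^-1 ^+ 2 * (k + s * p.2)^-1 ^+ 2)%:E))%E.
Proof.
move=> s1 mf f0.
have m1 : measurable_fun setT (fun p : plane R => p.1^-1 ^+ 2).
  exact: (measurableT_comp measurable_inv2 measurable_fst_plane).
have m2 : measurable_fun setT (fun p : plane R => (k + s * p.2)^-1 ^+ 2).
  apply: (measurableT_comp measurable_inv2); apply: measurable_funD => //.
  by apply: measurable_funM => //; exact: measurable_snd_plane.
rewrite fubini_tonelli1// [RHS]fubini_tonelli1//=; last 2 first.
- apply: emeasurable_funM; first exact: (measurableT_comp mf (measurable_branch s k)).
  by apply/measurable_EFinP; exact: measurable_funM.
- by move=> p; rewrite mule_ge0// lee_fin mulr_ge0// sqr_ge0.
rewrite /fubini_F (ge0_integral_inv_shift k s1); last 2 first.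
- exact: measurable_fun_fubini_tonelli_F.
- by move=> x; exact: integral_ge0.
apply: eq_integral => x _.
rewrite (ge0_integral_moebius k s1)//; last exact: measurable_fun_pair2.
rewrite -ge0_integralZr//.
- by apply: eq_integral => y _; rewrite -muleA -EFinM [X in X%:E]mulrC.
- apply: emeasurable_funM.
    have mb := measurableT_comp mf (measurable_branch s k).
    exact: (measurable_fun_pair2 x mb).
  have mky : measurable_fun setT (fun y : R => (k + s * y)^-1 ^+ 2).
    by apply: (measurableT_comp measurable_inv2); apply: measurable_funD.
  by apply/measurable_EFinP.
- by move=> y _; rewrite mule_ge0// lee_fin sqr_ge0.
- by rewrite lee_fin sqr_ge0.
Qed.

Definition kappa0 (p : plane R) : R := ((p.1 * p.2 + 1) ^+ 2)^-1.

Lemma measurable_kappa0 : measurable_fun setT kappa0.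
Proof.
apply: (measurableT_comp measurable_inv).
apply: (measurable_funX 2); apply: measurable_funD => //.
apply: measurable_funM; [exact: measurable_fst_plane|exact: measurable_snd_plane].
Qed.

Lemma kappa0_ge0 p : 0 <= kappa0 p.
Proof. by rewrite invr_ge0 sqr_ge0. Qed.

(** A branch multiplies [x y + 1] by [s / (x (k + s y))], and the square of this factor is the
    Jacobian. *)
Lemma kappa0_branch (s k : R) p : `|s| = 1 -> p.1 != 0 -> k + s * p.2 != 0 ->
  kappa0 (branch s k p) * (p.1^-1 ^+ 2 * (k + s * p.2)^-1 ^+ 2) = kappa0 p.
Proof.
case: p => x y /= s1 x0 ky0; have ss : s ^+ 2 = 1.
  by rewrite -real_normK ?num_real// s1 expr1n.
rewrite /kappa0/=.
have -> : (s * x^-1 - k) * (k + s * y)^-1 + 1 = s * (x * y + 1) / (x * (k + s * y)).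
  by field; rewrite ?x0 ?ky0.
rewrite -exprMn -invfM !expr_div_n exprMn ss mul1r invf_div mulrAC exprVn mulfV ?mul1r//.
by rewrite expf_neq0// mulf_neq0.
Qed.

(** The unnormalised invariant measure, kept on the whole plane so that each branch can be treated
    before [D] enters. *)
Definition kappa : set (plane R) -> \bar R :=
  weighted_pushforward (lebesgue2 R) (@measurable_id _ _ setT)
    measurable_kappa0 kappa0_ge0.
HB.instance Definition _ := Measure.on kappa.

Lemma kappaE A : (kappa A = \int[lebesgue2 R]_(p in A) (kappa0 p)%:E)%E.
Proof. by []. Qed.

Lemma kappa_branch (s k : R) (A : set (plane R)) : `|s| = 1 -> measurable A ->
  (forall p, A p -> p.1 != 0 /\ k + s * p.2 != 0) ->
  measurable (branch s k @` A) /\ kappa (branch s k @` A) = kappa A.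
Proof.
move=> s1 mA A0; have mbA : measurable (branch s k @` A).
  rewrite image_branch// -(setTI (_ @^-1` _)).
  exact: (measurable_branch_inv s k).
split=> //; rewrite !kappaE integral_mkcond (ge0_integral_branch k s1).
- rewrite [RHS]integral_mkcond; apply: eq_integral => p _.
  rewrite /restrict; have [/set_mem bA|bA] := ifPn.
    have Ap : A p by case: bA => q Aq /(can_inj (branchK k s1)) <-.
    by rewrite mem_set// -EFinM kappa0_branch//; have [] := A0 _ Ap.
  rewrite mul0e ifF//; apply/negP => /set_mem Ap; move/negP: bA; apply.
  by apply/mem_set; exists p.
- apply: (measurable_restrictT _ _).1 => //; apply: measurable_funTS.
  by apply/measurable_EFinP; exact: measurable_kappa0.
- by move=> p; apply: erestrict_ge0 => q _; rewrite lee_fin kappa0_ge0.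
Qed.

End Branches.

(** * The digit expansions defining the fibers *)

Ltac nlia := repeat match goal with
  | H : ?T |- _ => lazymatch T with
    | nat => fail
    | is_true (leq _ _) => fail
    | is_true (andb (leq _ _) (leq _ _)) => fail
    | @eq nat _ _ => fail
    | _ => clear H
    end
  end; lia.

Section Words.
Context {R : realType}.

Lemma V_gt0_lt1 (h : nat) (w : R) : (2 <= h)%N -> 0 < w < 1 -> 0 < V h w < 1.
Proof.
move=> h2 /andP[w0 w1]; have h2R : (2 : R) <= h%:R by rewrite ler_nat.
by rewrite /V invr_gt0 invf_lt1; lra.
Qed.

Lemma V_le (h : nat) (w w' : R) : w < h%:R -> w' < h%:R ->
  (V h w <= V h w') = (w <= w').
Proof. by move=> wh w'h; rewrite /V lef_pV2 ?posrE; lra. Qed.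

Lemma V_inj (h k : nat) (w w' : R) : 0 < w < 1 -> 0 < w' < 1 ->
  V h w = V k w' -> h = k /\ w = w'.
Proof.
move=> w01 w'01 /invr_inj E.
have [hk|hk|hk] := ltngtP h k.
- have : (h.+1%:R : R) <= k%:R by rewrite ler_nat.
  rewrite -natr1; lra.
- have : (k.+1%:R : R) <= h%:R by rewrite ler_nat.
  rewrite -natr1; lra.
- by split=> //; move: E; rewrite hk; lra.
Qed.

Context (r : nat) (hr : (3 <= r)%N).

Local Notation b := (beta R r).
Local Notation x := (xi R r).

Let hrR : (3 : R) <= r%:R. Proof. by rewrite ler_nat. Qed.

(** In other terms [b] is the fixed point of [V r.+1] in [(0, 1)], the smaller root of
    [t^2 - (r + 1) t + 1]. *)
Lemma beta_prop : [/\ 0 < b, b < 1, b * (r%:R + 1 - b) = 1 & 3 <= r%:R :> R].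
Proof.
have r3 := hrR; have D0 : 0 <= (r%:R + 1) ^+ 2 - 4 :> R.
  have -> : (r%:R + 1) ^+ 2 - 4 = (r%:R - 1) * (r%:R + 3) :> R by ring.
  by apply: mulr_ge0; lra.
have s2 := sqr_sqrtr D0; have s0 := sqrtr_ge0 ((r%:R + 1) ^+ 2 - 4 : R).
rewrite /beta; set s := Num.sqrt _ in s2 s0 *.
split=> //; [nra|nra|].
have -> : (r%:R + 1 - s) / 2 * (r%:R + 1 - (r%:R + 1 - s) / 2) =
  ((r%:R + 1) ^+ 2 - s ^+ 2) / 4 by field.
by rewrite s2; field.
Qed.

Lemma xi_bounds : 0 < x < 1.
Proof.
have [b0 b1 _ r3] := beta_prop.
by rewrite /xi invr_gt0 invf_lt1; lra.
Qed.

(* [endpoint (r - 1 - i)] is the upper end of the fiber of E over the i-th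
   strip for i >= 1, and over [0, 1/r] for i = 0. *)
Definition endpoint (m : nat) : R := 1 - (m%:R + 2 - b)^-1.

Lemma endpoint_bounds m : 0 < endpoint m < 1.
Proof.
have [b0 b1 _ r3] := beta_prop; have m0 : 0 <= m%:R :> R by [].
have : 0 < (m%:R + 2 - b)^-1 < 1 by rewrite invr_gt0 invf_lt1; lra.
rewrite /endpoint; lra.
Qed.

(** In the coordinate [t] given by [y = 1 - 1/t], the map [V 2] is the translation [t -> t + 1]. *)
Lemma endpointS m : endpoint m.+1 = V 2 (endpoint m).
Proof.
have [b0 b1 _ r3] := beta_prop; have m0 : 0 <= m%:R :> R by [].
rewrite /endpoint /V -natr1; field; apply/andP; split; apply/eqP; lra.
Qed.

Lemma endpoint_r2 : endpoint (r - 2) = 1 - x.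
Proof. by rewrite /endpoint /xi natrB ?subrK//; nlia. Qed.

Lemma endpoint_r1 : endpoint (r - 1) = 1 - b.
Proof.
have [b0 b1 bE r3] := beta_prop.
rewrite /endpoint natrB; last by nlia.
have -> : r%:R - 1%:R + 2 - b = b^-1 by apply: (mulfI (x := b)); rewrite ?gt_eqF// mulfV ?gt_eqF//; lra.
by rewrite invrK.
Qed.

(** The quadratic equation of [b] gives [xi = b / (1 - b)]. This closes the end points under the
    digits: [endpoint m] reads as [m] twos, a 3, then [1 - xi], which is itself
    [endpoint (r - 2)]. *)
Lemma endpoint0 : endpoint 0 = V 3 (1 - x).
Proof.
have [b0 b1 bE r3] := beta_prop.
have xE : x = b / (1 - b).
  have bx : b = x * (1 - b).
    have -> : 1 - b = (r%:R - b) * b by lra.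
    by rewrite /xi mulKf// gt_eqF//; lra.
  by rewrite [X in X / _]bx mulfK// gt_eqF//; lra.
rewrite /endpoint /V xE; field.
by rewrite !gt_eqF//; lra.
Qed.

Lemma M0_endpoint m : M0 (endpoint m.+1) = endpoint m.
Proof.
rewrite endpointS /M0 /V invrK.
have := endpoint_bounds m; set e := endpoint m => e01.
have -> : Num.floor (2 - e + 1) = 2.
  by apply: floor_def; rewrite intrD; lra.
lra.
Qed.

Lemma iter_M0_xi i : (1 <= i <= r - 1)%N ->
  iter (i - 1) M0 (1 - x) = endpoint (r - 1 - i).
Proof.
elim: i => // -[|i] IH i1; first by rewrite -endpoint_r2; congr endpoint; nlia.
have -> : (i.+2 - 1)%N = (i.+1 - 1).+1 by nlia.
rewrite iterS IH; last by nlia.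
have -> : (r - 1 - i.+1)%N = (r - 1 - i.+2).+1 by nlia.
exact: M0_endpoint.
Qed.

(* The words of H^ without their length, the first digit being constrained by
   [digit_in m M]; all the sets B^* are of this form, see [BsymE]. *)
Definition Cset (m M : nat) : set R := [set y | exists d t,
  [/\ digit_in m M d, all (digit_in (r - 2) r.+1) t, path admissible d t,
      is_big (last d t) & exists2 u, 1 - x < u < 1 & y = Vword (d :: t) u]].

Lemma BsymE s : Bsym R r s = match s with
  | Plus => Cset (r - 1) r
  | Minus => Cset (r - 2) r.+1
  | Idx i => Cset (r - 1 - i) r.+1 end.
Proof.
transitivity [set y : R | exists d t,
  [/\ first_digit r s d, all (digit_in (r - 2) r.+1) t, path admissible d t,
      is_big (last d t) & exists2 u, 1 - x < u < 1 & y = Vword (d :: t) u]];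
  last by case: s.
apply/seteqP; split=> y.
  move=> [n n1 [[|d t] [//= Hh lb]]] [u]; rewrite /= in_itv/= => u1 <-.
  by case: Hh => _ fd at_ pt; exists d, t; split=> //; exists u.
move=> [d [t [fd at_ pt lb [u u1 ->]]]]; exists (size t).+1 => //.
by exists (d :: t); [split|exists u; rewrite //= in_itv].
Qed.

Lemma Vword_bounds d t (u : R) : digit_in (r - 1) r.+1 d ->
  all (digit_in (r - 2) r.+1) t -> 0 < u < 1 -> 0 < Vword (d :: t) u < 1.
Proof.
have iterV s (v : R) : 0 < v < 1 -> 0 < iter s (V 2) v < 1.
  by move=> v01; elim: s => //= s IH; apply: V_gt0_lt1.
have Vd e M (v : R) : digit_in M r.+1 e -> 0 < v < 1 -> 0 < Vdigit e v < 1.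
  case: e => [s|h]/=; first by move=> _; exact: iterV.
  by move=> /andP[h3 _]; apply: V_gt0_lt1; exact: ltnW.
move=> dd at_ u01; rewrite /=; apply: (Vd _ _ _ dd).
by elim: t at_ => //= e t IH /andP[de /IH]; exact: (Vd _ _ _ de).
Qed.

Lemma Cset_bounds m M y : (m <= r - 1)%N -> (M <= r.+1)%N ->
  Cset m M y -> 0 < y < 1.
Proof.
move=> mr Mr [d [t [dd at_ _ _ [u u1 ->]]]]; apply: Vword_bounds => //.
  by move: dd; case: d => /= n; nlia.
have := xi_bounds; lra.
Qed.

(** Peels one digit at a time, a block of twos losing a single 2. As two blocks are never adjacent,
    the number of twos still allowed is all that has to be remembered; the special bound [M]
    concerns only the very first digit and becomes [r.+1] afterwards. *)
Lemma Cset_rec m M y : Cset m M y <->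
  (exists k w, [/\ (3 <= k <= M)%N, y = V k w &
      1 - x < w < 1 \/ Cset (r - 2) r.+1 w]) \/
  (exists w, [/\ (0 < m)%N, y = V 2 w & Cset (m - 1) r.+1 w]).
Proof.
split.
  move=> [[s|k] [t [/= dd at_ pt lb [u u1 ->]]]]; last first.
    left; exists k, (Vword t u); split=> //.
    case: t at_ pt lb => [|d t] /=; first by left.
    by move=> /andP[dd2 at_] pt lb; right; exists d, t; split=> //; exists u.
  case: t at_ pt lb => [|[s'|h] t] /=; [by []|by []|].
  move=> /andP[dd2 at_] pt lb.
  right; case: s dd => // -[|s] dd.
    exists (Vword (Big h :: t) u); split=> //; exists (Big h), t.
    by split=> //; exists u.
  exists (Vword (Twos s.+1 :: Big h :: t) u); split=> //; first by nlia.
  exists (Twos s.+1), (Big h :: t); split=> //=; first by nlia.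
    by rewrite dd2.
  by exists u.
move=> [[k [w [k3 -> [w1|]]]]|].
- by exists (Big k), [::]; split=> //; exists w.
- move=> [d [t [dd at_ pt lb [u u1 ->]]]]; exists (Big k), (d :: t).
  by split=> //=; [rewrite dd|exists u].
(* A word beginning with a block absorbs the new 2 into it; before a big digit the new 2 forms a
   block of length 1. *)
- move=> [w [m0 -> [[s|h] [t [/= dd at_ pt lb [u u1 ->]]]]]].
    exists (Twos s.+1), t; split=> //=; first by nlia.
    - by case: t {at_} pt lb.
    - by case: t {at_ pt} lb.
    - by exists u.
  exists (Twos 1), (Big h :: t); split=> //=; first by rewrite dd.
  by exists u.
Qed.

Lemma Cset_V m M (h : nat) (w : R) : (m <= r - 1)%N -> (M <= r.+1)%N ->
  0 < w < 1 ->
  Cset m M (V h w) <->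
  ((3 <= h <= M)%N /\ (1 - x < w \/ Cset (r - 2) r.+1 w)) \/
  [/\ h = 2%N, (0 < m)%N & Cset (m - 1) r.+1 w].
Proof.
move=> mr Mr w01; have xp := xi_bounds; rewrite Cset_rec; split.
  move=> [[k [w' [k3 E w'P]]]|[w' [m0 E Cw']]].
    have w'01 : 0 < w' < 1.
      by case: w'P => [|/Cset_bounds]; [lra|apply; nlia].
    have [-> ->] := V_inj w01 w'01 E; left; split=> //.
    by case: w'P => [/andP[]|]; [left|right].
  have w'01 : 0 < w' < 1 by apply: Cset_bounds Cw'; nlia.
  by have [-> ->] := V_inj w01 w'01 E; right.
move=> [[h3 wP]|[-> m0 Cw]]; [left|right].
  exists h, w; split=> //; case: wP; [left; lra|by right].
by exists w.
Qed.

(** The index counts the leading twos still available rather than the strip: strip [i] has the fiber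
    [fiber (r - 1 - i)], so that peeling a 2 lowers the index by one. *)
Definition fiber (m : nat) : set R :=
  [set y | 0 <= y <= endpoint m /\ ~ Cset m r.+1 y].

Definition fiber_pos : set R :=
  [set y | 0 <= y <= 1 - b /\ ~ Cset (r - 1) r y].

(** After a digit from 3 to [r.+1] the holes remove [w > 1 - xi] as well as [Cset (r - 2) r.+1],
    which leaves exactly [fiber (r - 2)]. For larger digits neither holes nor cut are met; after a 2
    both conditions pass to index [m - 1]. *)
Lemma fiber_V m h (w : R) : (m <= r - 2)%N -> (2 <= h)%N -> 0 < w < 1 ->
  fiber m (V h w) <->
  [\/ (r.+2 <= h)%N, (3 <= h <= r.+1)%N /\ fiber (r - 2) w |
      [/\ h = 2%N, (0 < m)%N & fiber (m - 1) w]].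
Proof.
move=> mr h2 w01; have xp := xi_bounds.
have V01 := V_gt0_lt1 h2 w01; have h2R : (2 : R) <= h%:R by rewrite ler_nat.
have mr1 : (m <= r - 1)%N by nlia.
rewrite /fiber /= endpoint_r2 Cset_V//.
(* [V h] maps []0, 1[] onto []1/h, 1/(h - 1)[]. Hence comparing with [endpoint m] is comparing first
   digits: that of [endpoint 0] is 3, that of the others is 2. *)
have Vle : V h w <= endpoint m <->
    [\/ (4 <= h)%N, h = 3%N /\ ((0 < m)%N \/ w <= 1 - x) |
        [/\ h = 2%N, (0 < m)%N & w <= endpoint (m - 1)]].
  have e0lt : 1 / 3 < endpoint 0 < 1 / 2.
    by rewrite endpoint0 /V !div1r !ltf_pV2 ?posrE; lra.
  have e1gt k : 1 / 2 < endpoint k.+1.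
    have := endpoint_bounds k.
    rewrite endpointS /V div1r => ek; rewrite ltf_pV2 ?posrE; lra.
  have h4V : (4 <= h)%N -> V h w < 1 / 3.
    rewrite -(ler_nat R) => h4.
    rewrite /V div1r ltf_pV2 ?posrE; lra.
  have h3V : h = 3%N -> V h w < 1 / 2.
    by move=> ->; rewrite /V div1r ltf_pV2 ?posrE; lra.
  have h2V : h = 2%N -> 1 / 2 < V h w.
    by move=> ->; rewrite /V div1r ltf_pV2 ?posrE; lra.
  split.
    have [h4 _|h4] := leqP 4 h; first by constructor 1.
    have [h3|h3] : h = 3%N \/ h = 2%N by nlia.
      case: m {mr mr1} => [|m _]; last by constructor 2; split=> //; left.
      by rewrite h3 endpoint0 V_le; [constructor 2; split=> //; right|lra|lra].
    case: m {mr mr1} => [|m]; first by have := h2V h3; lra.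
    rewrite h3 endpointS V_le; [|lra|have := endpoint_bounds m; lra].
    by constructor 3; split=> //; rewrite subSS subn0.
  case=> [/h4V h4|[h3 [m0|wx]]|[h3 m0 wm]].
  - by case: m {mr mr1} => [|m]; [lra|have := e1gt m; lra].
  - by case: m {mr mr1} m0 => // m _; have := e1gt m; have := h3V h3; lra.
  - case: m {mr mr1} => [|m]; last by have := e1gt m; have := h3V h3; lra.
    by rewrite h3 endpoint0 V_le; lra.
  - case: m {mr mr1} m0 wm => // m _; rewrite subSS subn0 h3 endpointS => wm.
    by rewrite V_le//; have := endpoint_bounds m; lra.
case/andP: w01 => w0 w1; case/andP: V01 => V0 V1.
rewrite (ltW V0) (ltW w0) /=.
split.
  move=> [/Vle + nC]; case=> [h4|[h3 _]|[h2' m0 wm]].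
  - have [hr2|hr2] := leqP r.+2 h; first by constructor 1.
    constructor 2; split; first by nlia.
    split; last by move=> Cw; apply: nC; left; split; [nlia|right].
    by rewrite leNgt; apply/negP => xw; apply: nC; left; split; [nlia|left].
  - constructor 2; split; first by nlia.
    split; last by move=> Cw; apply: nC; left; split; [nlia|right].
    by rewrite leNgt; apply/negP => xw; apply: nC; left; split; [nlia|left].
  - by constructor 3; split=> //; split=> // Cw; apply: nC; right; split.
case=> [h4|[h3 [wx nC]]|[h2' m0 [wm nC]]].
- split; first by apply/Vle; constructor 1; nlia.
  by move=> [[? _]|[? _ _]]; nlia.
- split.
    apply/Vle; have [h4|h4] := leqP 4 h; first by constructor 1.
    by constructor 2; split; [nlia|right].
  move=> [[_ [|//]]|[? _ _]]; [by rewrite ltNge wx|nlia].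
- split; first by apply/Vle; constructor 3.
  by move=> [[? _]|[_ _ //]]; nlia.
Qed.

(** The bounds of [Plus] make the digits 2 to [r] behave alike: with [r - 1] twos allowed, a leading
    2 leaves [r - 2] of them, the same state as after a big digit. *)
Lemma fiber_pos_V h (w : R) : (2 <= h)%N -> 0 < w < 1 ->
  fiber_pos (V h w) <->
  (r.+1 <= h)%N \/ ((2 <= h <= r)%N /\ fiber (r - 2) w).
Proof.
move=> h2 w01; have xp := xi_bounds.
have V01 := V_gt0_lt1 h2 w01; have h2R : (2 : R) <= h%:R by rewrite ler_nat.
rewrite /fiber_pos /fiber /= endpoint_r2 -endpoint_r1 Cset_V//.
have r1S : (r - 1)%N = (r - 2).+1 by nlia.
have Vle : V h w <= endpoint (r - 1) <-> (3 <= h)%N \/ h = 2%N /\ w <= 1 - x.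
  have := endpoint_bounds (r - 2); rewrite endpoint_r2 => e01.
  rewrite r1S endpointS endpoint_r2; have [h3|h3] := leqP 3 h.
    split=> _; first by left.
    move: h3; rewrite -(ler_nat R) => h3.
    by rewrite /V lef_pV2 ?posrE; lra.
  have -> : h = 2%N by nlia.
  rewrite V_le; [|lra|lra].
  by split=> [?|[//|[_ ?]]]; [right|].
have -> : (r - 1 - 1)%N = (r - 2)%N by nlia.
case/andP: w01 => w0 w1; case/andP: V01 => V0 V1.
rewrite (ltW V0) (ltW w0) /=.
split.
  move=> [/Vle wP nC]; have [hr1|hr1] := leqP r.+1 h; first by left.
  right; split; first by nlia.
  split.
    case: wP => [h3|[]//]; rewrite leNgt; apply/negP => xw.
    by apply: nC; left; split; [nlia|left].
  move=> Cw; apply: nC; have [h3|h3] := leqP 3 h.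
    by left; split; [nlia|right].
  by right; split; [nlia|nlia|].
case=> [hr1|[hr2 [wx nC]]].
  split; first by apply/Vle; left; nlia.
  by move=> [[? _]|[? _ _]]; nlia.
split.
  by apply/Vle; have [h3|h3] := leqP 3 h; [left|right; split; [nlia|]].
move=> [[_ [|//]]|[_ _ //]]; by rewrite ltNge wx.
Qed.

End Words.

(** * Duality between the two families of fibers *)

Section Irrational.
Context {R : realType}.
Implicit Types x : R.

Lemma irrationalV x : irrational x -> irrational x^-1.
Proof. by move=> ix [q _ qx]; apply: ix; exists q^-1 => //; rewrite fmorphV/= qx invrK. Qed.

Lemma irrationalN x : irrational x -> irrational (- x).
Proof. by move=> ix [q _ qx]; apply: ix; exists (- q) => //; rewrite rmorphN/= qx opprK. Qed.

Lemma irrationalDz (k : int) x : irrational x -> irrational (k%:~R + x).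
Proof.
move=> ix [q _ qx]; apply: ix; exists (q - k%:~R) => //.
by rewrite rmorphB/= ratr_int qx addrC addKr.
Qed.

Lemma irrationalDn (k : nat) x : irrational x -> irrational (k%:R + x).
Proof. by move=> ix; rewrite pmulrn; exact: irrationalDz. Qed.

Lemma irrational_neq (q : rat) x : irrational x -> x <> ratr q.
Proof. by move=> ix xq; apply: ix; exists q. Qed.

Lemma gauss_expansion x : irrational x -> 0 < x < 1 ->
  exists k x', [/\ (1 <= k)%N, irrational x', 0 < x' < 1 & x = (k%:R + x')^-1].
Proof.
move=> ix /andP[x0 x1]; have V1 : 1 < x^-1 by rewrite invf_gt1.
have V0 : 0 <= x^-1 by rewrite invr_ge0 ltW.
have /andP[fl fu] := floor_itv x^-1.
have kE : `|Num.floor x^-1|%N%:R = (Num.floor x^-1)%:~R :> R.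
  by rewrite pmulrn gez0_abs// floor_ge0.
have ifr : irrational (x^-1 - (Num.floor x^-1)%:~R).
  by rewrite addrC -intrN; apply: irrationalDz; exact: irrationalV.
exists `|Num.floor x^-1|%N, (x^-1 - (Num.floor x^-1)%:~R); split => //.
- by rewrite lt0n absz_eq0 gt_eqF// floor_gt0 ltW.
- rewrite subr_gt0 lt_neqAle fl andbT ltrBlDr addrC -intrD1 fu andbT.
  apply/eqP => E; apply: (irrational_neq (q := (Num.floor x^-1)%:~R)).
    exact: irrationalV ix.
  by rewrite ratr_int.
- by rewrite kE addrC subrK invrK.
Qed.

End Irrational.

Section Duality.
Context {R : realType} (r : nat) (hr : (3 <= r)%N).

Local Notation P := (@fiber R r (r - 2)).
Local Notation Fp := (@fiber_pos R r).

(** The regular quotient [k] is the by-excess digit [k + 1] followed by the reflected tail, since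
    [k + v = (k + 1) - (1 - v)]. *)
Lemma fiber_pos_gauss (k : nat) (v : R) : (1 <= k)%N -> 0 < v < 1 ->
  Fp (k%:R + v)^-1 <-> (r <= k)%N \/ P (1 - v).
Proof.
move=> k1 v01; have -> : (k%:R + v)^-1 = V k.+1 (1 - v).
  by rewrite /V -natr1; congr (_^-1); ring.
have v01' : 0 < 1 - v < 1 by lra.
rewrite (fiber_pos_V hr _ v01')//; split=> [[?|[_ ?]]|[?|Pv]]; [by left|by right|by left|].
have [kr|kr] := leqP r k; first by left.
by right; split=> //; apply/andP; split.
Qed.

(** Reflection turns the quotient [k + 1] into [k] twos, and the next quotient [l] into the digit
    [l + 2], which is at least 3. The bound [l + 2 <= r + 1] on that digit is the bound [l + 1 <= r]
    in [fiber_pos_V], so the two digit rules meet. *)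
Lemma fiber_shift (k m : nat) (v : R) : irrational v -> 0 < v < 1 ->
  (m <= r - 2)%N ->
  fiber r m (1 - (k.+1%:R + v)^-1) <-> (k <= m)%N /\ Fp v.
Proof.
move=> iv v01; elim: k m => [|k IH] m mr.
  have [l [w [l1 _ w01 vE]]] := gauss_expansion iv v01.
  have -> : 1 - (1%:R + v)^-1 = V l.+2 (1 - w).
    have l0 : 1 <= l%:R :> R by rewrite ler1n.
    rewrite vE /V -!natr1; field; apply/andP; split; apply/eqP; lra.
  have w01' : 0 < 1 - w < 1 by lra.
  rewrite (fiber_V hr mr _ w01')//.
  rewrite vE fiber_pos_gauss//; split.
    move=> [l2|[l2 Pw]|[l2 _ _]]; [|by split=> //; right|nlia].
    by split=> //; left.
  move=> [_ [rl|Pw]]; first by constructor 1.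
  have [rl|rl] := leqP r l; first by constructor 1.
  by constructor 2; split=> //; apply/andP; split.
have u01 : 0 < 1 - (k.+1%:R + v)^-1 < 1.
  have : 0 < (k.+1%:R + v)^-1 < 1.
    have k1 : (1 : R) <= k.+1%:R by rewrite ler1n.
    by rewrite invr_gt0 invf_lt1; lra.
  lra.
have -> : 1 - (k.+2%:R + v)^-1 = V 2 (1 - (k.+1%:R + v)^-1).
  have k0 : 0 <= k%:R :> R by [].
  rewrite /V -!natr1; field; apply/andP; split; apply/eqP; lra.
rewrite (fiber_V hr mr _ u01)//; split.
  move=> [?|[? _]|[_ m0]]; [nlia|nlia|].
  by rewrite IH; [move=> [km Fv]; split=> //; nlia|nlia].
move=> [km Fv]; constructor 3; split=> //; first by nlia.
by rewrite IH; [split=> //; nlia|nlia].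
Qed.

(* Almost everywhere, [fiber_pos] and the reflection v |-> 1 - v of
   [fiber (r - 2)] are complementary; these are the exceptions. *)
Definition selfdual_defect : set R := [set v | [/\ irrational v, 0 < v < 1 &
  (Fp v <-> P (1 - v))]].

Lemma selfdual_defect_gauss v : selfdual_defect v ->
  exists k v', [/\ (1 <= k < r)%N, selfdual_defect v' & v = (k%:R + v')^-1].
Proof.
move=> [iv v01 vP]; have [k [v' [k1 iv' v'01 vE]]] := gauss_expansion iv v01.
case: k k1 vE => // k k1 vE.
have {}vP : (r <= k.+1)%N \/ P (1 - v') <-> (k <= r - 2)%N /\ Fp v'.
  by rewrite -fiber_pos_gauss// -fiber_shift// -vE.
exists k.+1, v'; suff kr : (k.+1 < r)%N.
  have km : (k <= r - 2)%N by nlia.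
  split=> //; split=> //; split=> [Fv'|Pv'].
    by have [|//] := vP.2 (conj km Fv'); rewrite leqNgt kr.
  by have [] := vP.1 (or_intror Pv').
rewrite ltnNge; apply/negP => rk; have [km _] := vP.1 (or_introl rk).
nlia.
Qed.

End Duality.

(** * Measurability of the fibers and of the defect set *)

Section CodeDigit.

Definition digit_code (d : digit) : nat + nat :=
  match d with Twos s => inl s | Big h => inr h end.

Definition digit_decode (c : nat + nat) : digit :=
  match c with inl s => Twos s | inr h => Big h end.

Lemma digit_codeK : cancel digit_code digit_decode.
Proof. by case. Qed.

HB.instance Definition _ := Countable.copy digit (can_type digit_codeK).

End CodeDigit.

Section Measurability.
Context {R : realType} (r : nat).

Lemma measurable_V (h : nat) (A : set R) : measurable A -> measurable (V h @` A).
Proof.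
move=> mA; have -> : V h @` A = (fun y => h%:R - y^-1) @^-1` A.
  apply/seteqP; split=> [_ [w Aw <-]|y Ay] /=; first by rewrite /V invrK opprB addrC subrK.
  by exists (h%:R - y^-1) => //; rewrite /V opprB addrC subrK invrK.
rewrite -[X in measurable X]setTI.
have mf : measurable_fun setT (fun y : R => h%:R - y^-1).
  by apply: measurable_funB => //; exact: measurable_inv.
exact: mf.
Qed.

Lemma measurable_Vword (t : seq digit) (A : set R) :
  measurable A -> measurable (Vword t @` A).
Proof.
have mT s (C : set R) : measurable C -> measurable (iter s (V 2) @` C).
  elim: s => [|s IH] mC; first by rewrite /= image_id.
  have -> : iter s.+1 (V 2) @` C = V 2 @` (iter s (V 2) @` C).
    by rewrite image_comp.
  exact: (measurable_V _ (IH mC)).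
move=> mA; elim: t => [|d t IH]; first by rewrite /Vword/= image_id.
have -> : Vword (d :: t) @` A = Vdigit d @` (Vword t @` A) by rewrite image_comp.
by case: d => [s|h]; [exact: mT|exact: measurable_V].
Qed.

(** Words over the countable type [digit] are countable, so this is a countable union of images of
    an interval, and an image under [V h] is a preimage under [y -> h - 1/y]. *)
Lemma measurable_Cset m M : measurable (@Cset R r m M).
Proof.
pose ok (c : digit * seq digit) := [&& digit_in m M c.1,
  all (digit_in (r - 2) r.+1) c.2, path admissible c.1 c.2 & is_big (last c.1 c.2)].
have -> : @Cset R r m M = \bigcup_(c : digit * seq digit)
    (if ok c then Vword (c.1 :: c.2) @` `]1 - xi R r, 1[ else set0).
  apply/seteqP; split=> y.
    move=> [d [t [dd at_ pt lb [u u1 ->]]]]; exists (d, t) => //.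
    by rewrite /ok /= dd at_ pt lb; exists u; rewrite //= in_itv.
  move=> [[d t] _]; rewrite /ok /=; case: ifP => // /and4P[dd at_ pt lb].
  by move=> [u]; rewrite /= in_itv /= => u1 <-; exists d, t; split=> //; exists u.
apply: countable_bigcupT_measurable => // c.
by case: ifP => // _; apply: measurable_Vword; exact: measurable_itv.
Qed.

Lemma measurable_fiber m : measurable (@fiber R r m).
Proof.
have -> : @fiber R r m = `[0, endpoint r m] `\` Cset r m r.+1.
  by apply/seteqP; split=> y; rewrite /fiber /= in_itv/=.
by apply: measurableD; [exact: measurable_itv|exact: measurable_Cset].
Qed.

Lemma measurable_fiber_pos : measurable (@fiber_pos R r).
Proof.
have -> : @fiber_pos R r = `[0, 1 - beta R r] `\` Cset r (r - 1) r.
  by apply/seteqP; split=> y; rewrite /fiber_pos /= in_itv/=.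
by apply: measurableD; [exact: measurable_itv|exact: measurable_Cset].
Qed.

Lemma measurable_irrational : measurable (@irrational R).
Proof.
apply: measurableC; apply: countable_measurable => //.
exact: (card_le_trans (card_image_le _ _) (countableP _)).
Qed.

Lemma measurable_selfdual_defect : measurable (@selfdual_defect R r).
Proof.
have m1 : measurable ((fun v : R => 1 - v) @^-1` fiber r (r - 2)).
  rewrite -[X in measurable X]setTI.
  have mf : measurable_fun setT (fun y : R => 1 - y) by exact: measurable_funB.
  by apply: mf => //; exact: measurable_fiber.
pose Q := fun v : R => 1 - v.
have -> : @selfdual_defect R r = irrational `&` `]0, 1[ `&`
   ((fiber_pos r `&` Q @^-1` fiber r (r - 2)) `|`
    (~` fiber_pos r `&` ~` (Q @^-1` fiber r (r - 2)))).
  apply/seteqP; split=> v; rewrite /selfdual_defect/= in_itv/=.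
    move=> [iv v01 vP]; split=> //.
    have [Fv|nFv] := pselect (fiber_pos r v); [left|right]; split=> //; tauto.
  by move=> [[iv v01] [[Fv Pv]|[nFv nPv]]]; split.
apply: measurableI.
  by apply: measurableI; [exact: measurable_irrational|exact: measurable_itv].
by apply: measurableU; apply: measurableI => //;
  do ?apply: measurableC => //; exact: measurable_fiber_pos.
Qed.

End Measurability.

(** * Bounded partial quotients occur on a null set *)

Section BoundedQuotients.
Context {R : realType}.
Local Notation mu := (@lebesgue_measure R).

(** The absolute value matters only left of -1, where [weighted_pushforward] still asks for a
    nonnegative weight. *)
Let w (x : R) : R := `|(1 + x)^-1|.

Let mw : measurable_fun setT w.
Proof.
apply: (measurableT_comp (@normr_measurable R setT)).
by apply: (measurableT_comp measurable_inv); exact: measurable_funD.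
Qed.

Let w0 x : 0 <= w x. Proof. exact: normr_ge0. Qed.

Let gauss : {measure set (measurableTypeR R) -> \bar R} :=
  weighted_pushforward mu (@measurable_id _ _ setT) mw w0.

(* [w] is the Gauss density: summed over the branches with quotient < N, its
   transfer telescopes to 1/(1 + y) - 1/(N + y) <= (1 - 1/N) w(y). *)
Lemma lebesgue_bounded_quotients0 (N : nat) (S : set R) :
  measurable S -> S `<=` `]0, 1[ ->
  (forall v, S v -> exists k v', [/\ (1 <= k < N)%N, S v' & v = (k%:R + v')^-1]) ->
  mu S = 0%E.
Proof.
move=> mS S01 SN; pose W (k : nat) : set R := (fun v => (k%:R + v)^-1) @` S.
have WE k : W k = (fun y => y^-1 - k%:R) @^-1` S.
  apply/seteqP; split=> [_ [v Sv <-]|y Sy] /=; first by rewrite invrK addrAC subrr add0r.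
  by exists (y^-1 - k%:R) => //; rewrite addrC subrK invrK.
have mW k : measurable (W k).
  rewrite WE -[X in measurable X]setTI.
  have mf : measurable_fun setT (fun y : R => y^-1 - k%:R).
    by apply: measurable_funB => //; exact: measurable_inv.
  exact: mf.
pose g (k : nat) (y : R) : R := (k%:R + y)^-1 - (k.+1%:R + y)^-1.
have S0 y : S y -> 0 < y < 1 by move=> /S01; rewrite /= in_itv.
have mV k : measurable_fun setT (fun y : R => (k%:R + y)^-1).
  by apply: (measurableT_comp measurable_inv); exact: measurable_funD.
have mg k : measurable_fun setT (g k) by exact: measurable_funB.
have g0 k y : (0 < k)%N -> S y -> 0 <= g k y.
  move=> k0 /S0 y01; have k1 : 1 <= k%:R :> R by rewrite ler1n.
  by rewrite /g subr_ge0 lef_pV2 ?posrE -?natr1; lra.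
(* Transporting the density through [y -> 1/(k + y)] gives [1/((k + y)(k + 1 + y))], whose partial
   fractions are [g k]. *)
have gaussW k : (0 < k)%N -> gauss (W k) = (\int[mu]_(y in S) (g k y)%:E)%E.
  move=> k0; transitivity (\int[mu]_(y in W k) (w y)%:E)%E; first by [].
  rewrite integral_mkcond (ge0_integral_moebius k%:R (normr1 R)); last 2 first.
  - apply: (measurable_restrictT _ _).1 => //; apply: measurable_funTS.
    by apply/measurable_EFinP; exact: mw.
  - by move=> y; apply: erestrict_ge0 => q _; rewrite lee_fin.
  rewrite [RHS]integral_mkcond; apply: eq_integral => y _.
  rewrite mul1r /restrict.
  have -> : ((k%:R + y)^-1 \in W k) = (y \in S).
    by apply/idP/idP => /set_mem yS; apply/mem_set; move: yS;
      rewrite WE /= invrK addrAC subrr add0r.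
  case: ifPn => [/set_mem/S0 y01|]; last by rewrite mul0e.
  rewrite -EFinM; congr EFin.
  have k1 : 1 <= k%:R :> R by rewrite ler1n.
  have ky : 0 < k%:R + y by lra.
  rewrite /w /g ger0_norm -?natr1; last first.
    by rewrite invr_ge0 addr_ge0// invr_ge0 ltW.
  field.
  by rewrite !gt_eqF//; lra.
have gauss_lty : (gauss S < +oo)%E.
  apply: (@le_lt_trans _ _ (\int[mu]_(y in S) 1%:E)%E).
    apply: ge0_le_integral => //.
    - by move=> y _; rewrite lee_fin.
    - by apply/measurable_EFinP; exact: measurable_funTS.
    - move=> y /S0 y01; rewrite lee_fin /w ger0_norm ?invr_ge0; last by lra.
      by rewrite invf_le1; lra.
  rewrite integral_cst// mul1e; apply: (@le_lt_trans _ _ (mu `]0, 1[%classic)).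
    by apply: le_measure => //; rewrite inE//; exact: measurable_itv.
  by rewrite lebesgue_measure_itv/= lte01 -EFinB ltry.
(* The quotients below [N] are [1, ..., M], hence the index shift in [W j.+1]. *)
pose M := N.-1; have M0 : 0 <= M%:R :> R by [].
have leS : (gauss S <= (1 - (M%:R + 1)^-1)%:E * gauss S)%E.
  apply: (@le_trans _ _ (gauss (\big[setU/set0]_(j < M) W j.+1))).
    apply: le_measure; rewrite ?inE//.
      by apply: bigsetU_measurable => j _; exact: mW.
    move=> v /SN[k [v' [k1 Sv' ->]]]; rewrite -(bigcup_mkord M (fun j => W j.+1)).
    by exists k.-1; [rewrite /M/=; lia|exists v' => //; rewrite prednK//; lia].
  apply: (@le_trans _ _ (\sum_(j < M) gauss (W j.+1))%E).
    by apply: (Boole_inequality gauss (A := fun j => W j.+1)) => j _; exact: mW.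
  under eq_bigr do rewrite gaussW//.
  rewrite -ge0_integral_sum//; last 2 first.
  - by move=> j; apply/measurable_EFinP; exact: (measurable_funTS (mg _)).
  - by move=> j y Sy; rewrite lee_fin g0.
  have -> : ((1 - (M%:R + 1)^-1)%:E * gauss S =
      \int[mu]_(y in S) ((1 - (M%:R + 1)^-1)%:E * (w y)%:E))%E.
    rewrite ge0_integralZl//.
    - by apply/measurable_EFinP; exact: measurable_funTS.
    - by move=> y _; rewrite lee_fin.
    - by rewrite lee_fin subr_ge0 invf_le1; lra.
  apply: ge0_le_integral => //.
  - by move=> y Sy; apply: sume_ge0 => j _; rewrite lee_fin g0.
  - by apply: emeasurable_sum => j; apply/measurable_EFinP; exact: (measurable_funTS (mg _)).
  - apply: emeasurable_funM => //.
    by apply/measurable_EFinP; exact: measurable_funTS.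
  move=> y /S0 y01; rewrite sumEFin -EFinM lee_fin.
  have -> : \sum_(j < M) g j.+1 y = (1 + y)^-1 - (M.+1%:R + y)^-1.
    elim: (M) => [|n IH]; first by rewrite big_ord0 subrr.
    by rewrite big_ord_recr/= IH /g addrA subrK.
  rewrite /w ger0_norm ?invr_ge0; last by lra.
  (* What remains is [M + 1 + y <= (M + 1)(1 + y)]. *)
  rewrite mulrBl mul1r lerD2l lerN2 -natr1 -invfM lef_pV2 ?posrE.
  - by nra.
  - by nra.
  - by lra.
(* A finite mass bounded by a factor below 1 times itself vanishes; this is where [gauss_lty] is
   needed. *)
have gauss0 : gauss S = 0%E.
  have gfin : gauss S \is a fin_num by rewrite ge0_fin_numE.
  have a0 : 0 <= fine (gauss S) by exact: fine_ge0.
  move: leS; rewrite -(fineK gfin); set a := fine _ in a0 *.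
  rewrite -EFinM lee_fin => aM.
  congr EFin; have : 0 < (M%:R + 1)^-1 :> R by rewrite invr_gt0; lra.
  by nra.
(* On []0, 1[] the Gauss density is at least 1/2, so the Lebesgue measure is at most twice the Gauss
   measure. *)
apply/eqP; rewrite eq_le measure_ge0 andbT.
have <- : (2%:E * gauss S = 0)%E by rewrite gauss0 mule0.
have -> : (2%:E * gauss S = \int[mu]_(y in S) (2%:E * (w y)%:E))%E.
  rewrite ge0_integralZl//; last by move=> y _; rewrite lee_fin.
  by apply/measurable_EFinP; exact: measurable_funTS.
rewrite -[X in (X <= _)%E]mul1e -integral_cst//.
apply: ge0_le_integral => //.
- apply: emeasurable_funM => //.
  by apply/measurable_EFinP; exact: measurable_funTS.
move=> y /S0 y01; rewrite -EFinM lee_fin /w ger0_norm ?invr_ge0; last by lra.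
by rewrite -[2]invrK -invfM invf_ge1; lra.
Qed.

End BoundedQuotients.

Lemma selfdual_defect_null {R : realType} (r : nat) : (3 <= r)%N ->
  lebesgue_measure (@selfdual_defect R r) = 0%E.
Proof.
move=> hr; apply: (@lebesgue_bounded_quotients0 _ r).
- exact: measurable_selfdual_defect.
- by move=> v [_ v01 _]; rewrite /= in_itv.
- by move=> v /(selfdual_defect_gauss hr).
Qed.

(** * The fibers of D *)

Section Sections.
Context {R : realType} (r : nat) (hr : (3 <= r)%N).
Implicit Types x y : R.

(** The interior of strip [i], read as: [i] is the first regular partial quotient of [1 + x]. This
    form makes levels easy to follow along the map. *)
Definition level (i : nat) x := i%:R < (1 + x)^-1 < i.+1%:R.

Lemma level_gt0 i x : (1 <= i)%N -> level i x -> 0 < 1 + x < 1.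
Proof.
rewrite -(ler_nat R) => i1 /andP[ix _].
have V1 : 1 < (1 + x)^-1 by lra.
have x0 : 0 < 1 + x by rewrite -invr_gt0; lra.
by rewrite x0 -invf_gt1.
Qed.

Lemma levelE i x : (1 <= i)%N -> level i x = (i.+1%:R^-1 < 1 + x < i%:R^-1).
Proof.
move=> i1; have i0 : 0 < i%:R :> R by rewrite ltr0n.
have iS0 : 0 < i.+1%:R :> R by rewrite ltr0n.
apply/idP/idP.
  move=> lx; have /andP[x0 _] := level_gt0 i1 lx.
  by move: lx => /andP[]; rewrite invf_pgt// invf_plt// => -> ->.
move=> /andP[x1 x2]; have x0 : 0 < 1 + x by apply: lt_trans x1; rewrite invr_gt0.
by rewrite /level invf_pgt// invf_plt// x1 x2.
Qed.

Lemma level_exists x : irrational x -> r%:R^-1 - 1 < x < 0 ->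
  exists2 i, (1 <= i <= r - 1)%N & level i x.
Proof.
move=> ix /andP[x1 x0]; have r0 : 0 < r%:R :> R by rewrite ltr0n; nlia.
have rV0 : 0 < r%:R^-1 :> R by rewrite invr_gt0.
have i1x : irrational (1 + x) by have := @irrationalDn R 1 x ix; rewrite mulr1n.
have x01 : 0 < 1 + x < 1 by lra.
have [i [x' [i1 _ x'01 xE]]] := gauss_expansion i1x x01.
have lx : level i x by rewrite /level xE invrK -natr1; lra.
exists i => //; rewrite i1 /=.
have : (1 + x)^-1 < r%:R by rewrite invf_plt ?posrE; lra.
case/andP: lx => lx _ /(lt_trans lx); rewrite ltr_nat; nlia.
Qed.

Lemma level_bounds i x : (1 <= i <= r - 1)%N -> level i x ->
  r%:R^-1 - 1 < x < 0.
Proof.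
move=> /andP[i1 ir] lx; have := level_gt0 i1 lx => x01.
move: lx; rewrite levelE// => /andP[+ _].
have : (r%:R^-1 : R) <= i.+1%:R^-1.
  by rewrite lef_pV2 ?posrE ?ltr0n ?ler_nat; nlia.
move=> /le_lt_trans/[apply]; rewrite ltrBlDl => ->.
by case/andP: x01 => _; rewrite gtrDl.
Qed.

Lemma stripE i x : (1 <= i)%N -> strip R i x <-> i.+1%:R^-1 <= 1 + x <= i%:R^-1.
Proof.
move=> i1; have i0 : 1 <= i%:R :> R by rewrite ler1n.
rewrite /strip /= in_itv /= -natr1.
have -> : i%:R / (i%:R + 1) = 1 - (i%:R + 1)^-1 :> R by field; lra.
have -> : (i%:R - 1) / i%:R = 1 - i%:R^-1 :> R by field; lra.
by split=> /andP[h1 h2]; apply/andP; split; lra.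
Qed.

Lemma strip_level i j x : (1 <= i)%N -> (1 <= j)%N -> level i x ->
  strip R j x <-> j = i.
Proof.
move=> i1 j1 lx; rewrite stripE//; split=> [|->].
  have /andP[x0 _] := level_gt0 i1 lx.
  case/andP: lx => l1 l2 /andP[s1 s2].
  have : (1 + x)^-1 <= j.+1%:R by rewrite invf_ple ?posrE ?ltr0n.
  have : j%:R <= (1 + x)^-1 by rewrite -[leLHS]invrK lef_pV2 ?posrE ?invr_gt0 ?ltr0n.
  move=> jx xj; apply/eqP; rewrite eqn_leq.
  have := le_lt_trans jx l2; rewrite ltr_nat ltnS => ->.
  by have := lt_le_trans l1 xj; rewrite ltr_nat ltnS => ->.
by move: lx; rewrite levelE// => /andP[/ltW-> /ltW->].
Qed.

(** [B^-] obeys the digit bounds that [B^i] would have for [i = 1], and level 1 is the only one that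
    meets [[-1/2, 0]]; this fills the gap left by the union over [i >= 2]. *)
Lemma D_level i x y : (1 <= i <= r - 1)%N -> level i x ->
  D R r (x, y) <-> fiber r (r - 1 - i) y.
Proof.
move=> ir lx; have /andP[xl x0] := level_bounds ir lx.
have i1 : (1 <= i)%N by nlia.
have Ey : E R r (x, y) <-> 0 <= y <= endpoint r (r - 1 - i).
  rewrite /E /bigcup /setU /= !in_itv/=; split.
    move=> [[j jr [sj]]|[/andP[]]]; last by rewrite leNgt x0.
    have j1 : (1 <= j)%N by nlia.
    have {sj} -> := (strip_level i1 j1 lx).1 sj.
    by rewrite in_itv/= iter_M0_xi.
  move=> yi; left; exists i => //=; split; first exact/(strip_level i1 i1 lx).
  by rewrite in_itv/= iter_M0_xi.
have By : B R r (x, y) <-> Cset r (r - 1 - i) r.+1 y.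
  rewrite /B /bigcup /setU /= !in_itv/= !BsymE; split.
    move=> [[[j jr [sj]]|[xh]]|[/andP[]]]; last by rewrite leNgt x0.
      have j1 : (1 <= j)%N by nlia.
      by rewrite BsymE/= => Cy; have <- := (strip_level i1 j1 lx).1 sj.
    suff -> : i = 1%N by have -> : (r - 1 - 1)%N = (r - 2)%N by nlia.
    case/andP: lx => l1 _; have : (1 + x)^-1 <= 2 by rewrite invf_ple ?posrE; lra.
    by move=> /(lt_le_trans l1); rewrite (ltr_nat R i 2); nlia.
  move=> Cy; left; have [i2|i2] := leqP 2 i.
    by left; exists i; [nlia|split; [exact/(strip_level i1 i1 lx)|rewrite BsymE]].
  right; have iE : i = 1%N by nlia.
  move: Cy; rewrite iE; have -> : (r - 1 - 1)%N = (r - 2)%N by nlia.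
  move=> Cy; split=> //; apply/andP; split; last exact: ltW.
  by move: lx; rewrite levelE// iE => /andP[+ _]; lra.
rewrite /D /fiber /setD /=; split=> -[/Ey ? nB]; split=> //.
  by move=> Cy; apply: nB; exact/By.
by move=> /By.
Qed.

Lemma D_pos x y : 0 < x < r%:R^-1 -> D R r (x, y) <-> fiber_pos r y.
Proof.
move=> /andP[x0 xr].
have nstrip i : (1 <= i)%N -> ~ strip R i x.
  move=> i1; rewrite stripE// => /andP[_].
  have : (i%:R^-1 : R) <= 1 by rewrite invf_le1 ?ltr0n// ler1n.
  lra.
rewrite /D /E /B /fiber_pos /bigcup /setU /setD /= !in_itv/= !BsymE.
rewrite (ltW x0) (ltW xr) /=; split.
  move=> [[[j jr [+ _]]|[_ yb]] nB]; first by move=> /nstrip; case; nlia.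
  by split=> // Cy; apply: nB; right.
move=> [yb nC]; split; first by right.
move=> [[[j jr [+ _]]|[]]|[]//]; first by move=> /nstrip; case; nlia.
by move=> /andP[_]; rewrite leNgt x0.
Qed.

Lemma D_domain x y : irrational x -> D R r (x, y) ->
  0 < x < r%:R^-1 \/ exists2 i, (1 <= i <= r - 1)%N & level i x.
Proof.
move=> ix [Exy _]; have r0 : 0 < r%:R :> R by rewrite ltr0n; nlia.
have xq q : x <> ratr q by exact: irrational_neq.
have xr : x != r%:R^-1 by apply/eqP => xE; apply: (xq (r%:R^-1)); rewrite fmorphV/= ratr_nat.
have x0 : x != 0 by apply/eqP => xE; apply: (xq 0); rewrite rmorph0.
have xr1 : x != r%:R^-1 - 1.
  apply/eqP => xE; apply: (xq (r%:R^-1 - 1)).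
  by rewrite rmorphB/= fmorphV/= ratr_nat rmorph1.
case: Exy => [[i ir [/= /stripE]]|[/=]]; last first.
  rewrite in_itv/= => /andP[x0' xr'] _; left.
  by rewrite !lt_neqAle eq_sym x0 x0' xr xr'.
case/andP: ir => i1 ir /(_ i1)/andP[s1 s2] _; right; apply: level_exists => //.
have : (r%:R^-1 : R) <= i.+1%:R^-1.
  by rewrite lef_pV2 ?posrE ?ltr0n ?ler_nat; nlia.
have : (i%:R^-1 : R) <= 1 by rewrite invf_le1 ?ltr0n// ler1n.
move=> i1' ri; rewrite !lt_neqAle eq_sym xr1 x0 /= lerBlDl (le_trans ri s1)/=.
by have := le_trans s2 i1'; rewrite gerDl.
Qed.

(** The end points increase with their index, so the one over [[0, 1/r]] dominates. This uniform
    bound below 1 is the contraction rate in [approx_error]. *)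
Lemma D_snd x y : irrational x -> D R r (x, y) -> 0 <= y <= 1 - beta R r.
Proof.
move=> ix Dxy; have [xp|[i ir lx]] := D_domain ix Dxy.
  by move: Dxy; rewrite D_pos// => -[].
move: Dxy; rewrite (D_level _ ir lx) => -[/andP[-> yi] _] /=.
have [b0 b1 bE r3] := @beta_prop R r hr; apply: (le_trans yi).
rewrite -endpoint_r1// /endpoint lerD2l lerN2.
have h : ((r - 1 - i)%N%:R : R) <= (r - 1)%N%:R by rewrite ler_nat; nlia.
have h0 : 0 <= ((r - 1 - i)%N%:R : R) by [].
by rewrite lef_pV2 ?posrE; lra.
Qed.

End Sections.

Section Dynamics.
Context {R : realType} (r : nat) (hr : (3 <= r)%N).
Implicit Types x y v : R.

Local Notation alpha := (r%:R^-1 : R).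
Local Notation P := (@fiber R r (r - 2)).
Local Notation Fp := (@fiber_pos R r).
Local Notation Dr := (@D R r).

Definition in_dom x := alpha - 1 < x < alpha.

Lemma alpha_bounds : [/\ 0 < alpha, alpha < 1 / 2, alpha * r%:R = 1 & 3 <= r%:R :> R].
Proof.
have r3 : 3 <= r%:R :> R by rewrite ler_nat.
have aE : alpha * r%:R = 1 by rewrite mulVf// gt_eqF//; lra.
have a0 : 0 < alpha by rewrite invr_gt0; lra.
by split=> //; nra.
Qed.

Lemma in_dom_D x y : irrational x -> Dr (x, y) -> in_dom x.
Proof.
have [a0 a1 _ _] := alpha_bounds.
move=> ix /(D_domain hr ix)[|[i ir lx]]; rewrite /in_dom; first by lra.
by have := level_bounds hr ir lx; lra.
Qed.

Lemma D_inv x' (k : nat) v : in_dom x' -> irrational x' -> (1 <= k)%N ->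
  Dr ((x' + k%:R)^-1, v) <-> r%:R < x' + k%:R /\ Fp v.
Proof.
move=> xd ix k1; have [a0 a1 aE r3] := alpha_bounds; move: xd; rewrite /in_dom => xd.
have k1R : 1 <= k%:R :> R by rewrite ler1n.
have z0 : 0 < x' + k%:R by lra.
have iz : irrational (x' + k%:R)^-1.
  by apply: irrationalV; rewrite addrC; exact: irrationalDn.
split=> [Dx|[rz Fv]].
  have [xb|[i ir lx]] := D_domain hr iz Dx; last first.
    by have := level_bounds hr ir lx => /andP[_]; rewrite invr_lt0; lra.
  split; last exact/(D_pos hr v xb).
  by case/andP: xb => _; rewrite ltf_pV2 ?posrE; lra.
by apply/(D_pos hr) => //; rewrite invr_gt0 z0 ltf_pV2 ?posrE; lra.
Qed.

(** The level of the negative candidate is one more than the integer part of [1/(x' + k)]: it is 1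
    if [x' + k > 1], and [j + 1] if [k = 1] and [x'] has level [j]. *)
Lemma level_Ninv x' (k i : nat) : in_dom x' -> (1 <= k)%N ->
  level i.+1 (- (x' + k.+1%:R)^-1) = (i%:R < (x' + k%:R)^-1 < i.+1%:R).
Proof.
have [a0 a1 aE r3] := alpha_bounds; rewrite /in_dom => xd k1.
have k1R : 1 <= k%:R :> R by rewrite ler1n.
rewrite /level.
have -> : (1 - (x' + k.+1%:R)^-1)^-1 = 1 + (x' + k%:R)^-1.
  by rewrite -natr1; field; apply/andP; split; apply/eqP; lra.
by rewrite -[in i.+2%:R]natr1 -[in X in X < _]natr1 ![_ + 1]addrC !ltrD2l.
Qed.

Lemma D_Ninv1 x' (k : nat) v : in_dom x' -> 1 < x' + k%:R ->
  Dr (- (x' + k.+1%:R)^-1, v) <-> P v.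
Proof.
have [a0 a1 aE r3] := alpha_bounds => xd xk; have := xd; rewrite /in_dom => xd'.
have k1 : (1 <= k)%N by rewrite -(ltr_nat R) in xk *; lra.
have lx : level 1 (- (x' + k.+1%:R)^-1).
  by rewrite level_Ninv// invr_gt0 invf_lt1; lra.
have r1 : (1 <= 1 <= r - 1)%N by nlia.
rewrite (D_level hr _ r1 lx); by have -> : (r - 1 - 1 = r - 2)%N by nlia.
Qed.

Lemma D_Ninv_level x' (j : nat) v : irrational x' -> (1 <= j <= r - 1)%N ->
  level j x' ->
  Dr (- (x' + 2%:R)^-1, v) <-> (0 < r - 1 - j)%N /\ fiber r (r - 1 - j - 1) v.
Proof.
have [a0 a1 aE r3] := alpha_bounds => ix jr lx.
have xd := level_bounds hr jr lx.
have xd' : in_dom x' by rewrite /in_dom; lra.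
have lx2 : level j.+1 (- (x' + 2%:R)^-1) by rewrite level_Ninv// addrC.
have [jr1|jr1] := ltnP j (r - 1).
  have jr2 : (1 <= j.+1 <= r - 1)%N by nlia.
  rewrite (D_level hr _ jr2 lx2).
  have -> : (r - 1 - j.+1 = r - 1 - j - 1)%N by nlia.
  by split=> [|[]//]; split=> //; nlia.
(* At [j = r - 1] the candidate would have level [r], which no strip provides. *)
split=> [Dx|[? _]]; last by nlia.
have i2 : irrational (- (x' + 2%:R)^-1).
  by apply/irrationalN/irrationalV; rewrite addrC; exact: irrationalDn.
have [|[i ir li]] := D_domain hr i2 Dx.
  by move=> /andP[+ _]; rewrite oppr_gt0 invr_lt0; lra.
case/andP: lx2 => l1 l2; case/andP: li => m1 m2.
by have := lt_trans l1 m2; rewrite ltr_nat; nlia.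
Qed.

(* The points in the statements [a] and [b] are the only candidates for a
   preimage of the point in [c]. *)
Lemma D_cover x' (k : nat) v : irrational x' -> in_dom x' -> irrational v ->
  0 < v < 1 -> (1 <= k)%N ->
  let c := Dr (x', (k%:R + v)^-1) in
  let a := Dr ((x' + k%:R)^-1, v) in
  let b := Dr (- (x' + k.+1%:R)^-1, 1 - v) in
  [/\ a -> c, b -> c, c -> ~ selfdual_defect r v -> a \/ b
    & a -> b -> selfdual_defect r v].
Proof.
move=> ix xd iv v01 k1 c a b; have [a0 a1 aE r3] := alpha_bounds.
have xd' := xd; rewrite /in_dom in xd'.
have k1R : 1 <= k%:R :> R by rewrite ler1n.
have aE' : a <-> r%:R < x' + k%:R /\ Fp v by exact: D_inv.
have defE : selfdual_defect r v <-> (Fp v <-> P (1 - v)) by split=> [[]|].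
have VE : (k%:R + v)^-1 = V k.+1 (1 - v).
  by rewrite /V -natr1; congr (_^-1); ring.
have v01' : 0 < 1 - v < 1 by lra.
have [x0|x0] := ltP 0 x'.
  have cE : c <-> (r <= k)%N \/ P (1 - v).
    by rewrite /c D_pos ?fiber_pos_gauss//; lra.
  have bE : b <-> P (1 - v) by apply: D_Ninv1 => //; lra.
  have rk : r%:R < x' + k%:R <-> (r <= k)%N.
    split=> [rk|]; last by rewrite -(ler_nat R); lra.
    by rewrite -ltnS -(ltr_nat R) -natr1; lra.
  by have [Fv|nFv] := pselect (Fp v); have [Pv|nPv] := pselect (P (1 - v));
    split; tauto.
(* For negative [x'] the positive candidate needs [r < k] instead of [r <= k]. The case [k = 1] is
   separate: the negative candidate climbs one level and alone accounts for the point, without any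
   duality. *)
have x0' : x' < 0.
  rewrite lt_neqAle x0 andbT; apply/eqP => xE.
  by apply: (irrational_neq (q := 0) ix); rewrite rmorph0.
have rk : r%:R < x' + k%:R <-> (r < k)%N.
  split=> [rk|]; first by rewrite -(ltr_nat R); lra.
  by rewrite -(ler_nat R) -natr1; lra.
have [j jr lx] : exists2 j, (1 <= j <= r - 1)%N & level j x'.
  by apply: (level_exists hr) => //; lra.
have jm : (r - 1 - j <= r - 2)%N by nlia.
have cE : c <-> [\/ (r < k)%N, (2 <= k <= r)%N /\ P (1 - v) |
    [/\ k = 1%N, (0 < r - 1 - j)%N & fiber r (r - 1 - j - 1) (1 - v)]].
  rewrite /c VE (D_level hr _ jr lx) (fiber_V hr jm _ v01')//.
  have -> : (k.+1 = 2%N) = (k = 1%N) by apply/propext; split; nlia.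
  by [].
have [k2|k2] := leqP 2 k.
  have k2R : 2 <= k%:R :> R by rewrite (ler_nat R 2).
  have bE : b <-> P (1 - v) by apply: D_Ninv1 => //; lra.
  have cE' : c <-> (r < k)%N \/ P (1 - v).
    rewrite cE k2 /=; split=> [[|[_ ?]|[? _ _]]|[?|?]]; [by left|by right|nlia|by constructor 1|].
    by have [?|?] := ltnP r k; [constructor 1|constructor 2].
  by have [Fv|nFv] := pselect (Fp v); have [Pv|nPv] := pselect (P (1 - v));
    split; tauto.
have kE : k = 1%N by nlia.
have bE : b <-> c.
  rewrite /b cE kE (D_Ninv_level _ ix jr lx).
  by split=> [[? ?]|[?|[? _]|[_ ? ?]]]; [constructor 3|nlia|nlia|].
have na : ~ a by rewrite aE' rk => -[? _]; nlia.
by have [Fv|nFv] := pselect (Fp v); have [Pv|nPv] := pselect (P (1 - v));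
    split; tauto.
Qed.

End Dynamics.

(** * The map on D *)

Section Bijection.
Context {R : realType} (r : nat) (hr : (3 <= r)%N).
Implicit Types x y v : R.

Local Notation alpha := (r%:R^-1 : R).

Lemma k_E x (x' : R) (k : nat) : in_dom r x' -> (1 <= k)%N ->
  `|x^-1| = x' + k%:R -> k_ alpha x = k%:Z.
Proof.
move=> xd k1 E; rewrite /k_ E; apply: floor_def.
by move: xd; rewrite /in_dom intrD -pmulrn => xd; lra.
Qed.

Lemma Tbar_pos x' (k : nat) v : in_dom r x' -> (1 <= k)%N ->
  let x := (x' + k%:R)^-1 in
  Tbar alpha (x, v) = (x', (k%:R + v)^-1) /\ 0 < x.
Proof.
move=> xd k1 x; have [a0 a1 _ _] := @alpha_bounds R r hr.
have k1R : 1 <= k%:R :> R by rewrite ler1n.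
have z0 : 0 < x' + k%:R by move: xd; rewrite /in_dom; lra.
have x0 : 0 < x by rewrite invr_gt0.
have nx : `|x^-1| = x' + k%:R by rewrite invrK ger0_norm// ltW.
split=> //; rewrite /Tbar /T_ /= (@k_E x x' k)// nx gtr0_sg// mul1r -pmulrn.
by rewrite addrK.
Qed.

(** The shift to [k.+1] and the reflection to [1 - v] compensate, which gives both candidates the
    same image. *)
Lemma Tbar_neg x' (k : nat) v : in_dom r x' -> (1 <= k)%N ->
  let x := - (x' + k.+1%:R)^-1 in
  Tbar alpha (x, 1 - v) = (x', (k%:R + v)^-1) /\ x < 0.
Proof.
move=> xd k1 x; have [a0 a1 _ _] := @alpha_bounds R r hr.
have k1R : 1 <= k.+1%:R :> R by rewrite ler1n.
have z0 : 0 < x' + k.+1%:R by move: xd; rewrite /in_dom; lra.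
have x0 : x < 0 by rewrite oppr_lt0 invr_gt0.
have nx : `|x^-1| = x' + k.+1%:R by rewrite invrN invrK normrN ger0_norm// ltW.
split=> //; rewrite /Tbar /T_ /= (@k_E x x' k.+1)// nx ltr0_sg// -pmulrn addrK.
by congr (_, _^-1); rewrite -natr1; ring.
Qed.

Lemma T_expansion x : irrational x -> in_dom r x ->
  exists k x', [/\ (1 <= k)%N, irrational x', in_dom r x' &
    x = (x' + k%:R)^-1 \/ x = - (x' + k.+1%:R)^-1].
Proof.
move=> ix xd; have [a0 a1 aE r3] := @alpha_bounds R r hr.
have x0 : x != 0.
  by apply/eqP => xE; apply: (irrational_neq (q := 0) ix); rewrite rmorph0.
have ia : irrational `|x^-1|.
  by case: (ger0P x^-1) => _; [|apply: irrationalN]; exact: irrationalV.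
pose m := k_ alpha x; have /andP[ml mu] := floor_itv (`|x^-1| + 1 - alpha).
rewrite -/(k_ alpha x) -/m intrD in ml mu.
have ix' : irrational (`|x^-1| - m%:~R) by rewrite addrC -intrN; exact: irrationalDz.
have xd' : in_dom r (`|x^-1| - m%:~R).
  rewrite /in_dom; apply/andP; split; last by lra.
  rewrite lt_neqAle; apply/andP; split; last by lra.
  apply/eqP => xE; apply: (irrational_neq (q := r%:R^-1 - 1) ix').
  by rewrite -xE rmorphB/= fmorphV/= ratr_nat rmorph1.
have nx : (1 - alpha) * `|x^-1| > 1.
  move: xd; rewrite /in_dom => /andP[xl xu].
  have xn : `|x| < 1 - alpha by rewrite ltr_norml; lra.
  rewrite normfV mulrC ltr_pdivlMl ?normr_gt0//; lra.
have m1 : 1 <= m by rewrite /m /k_ floor_ge_int; nra.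
have mE : m = `|m|%N by rewrite gez0_abs// (le_trans _ m1).
have mR : `|m|%N%:R = m%:~R :> R by rewrite pmulrn -mE.
have am1 : (1 <= `|m|)%N by rewrite -lez_nat -mE.
have [xp|xn] := ltP 0 x.
  exists `|m|%N, (`|x^-1| - m%:~R); split=> //; left.
  by rewrite mR subrK ger0_norm ?invrK// invr_ge0 ltW.
have xlt : x < 0 by rewrite lt_neqAle x0.
(* From [|1/x| > 1/(1 - alpha) > 1 + alpha]; it ensures that the predecessor of [m] is still at
   least 1. *)
have m2 : 2 <= m by rewrite /m /k_ floor_ge_int; nra.
exists (`|m|.-1)%N, (`|x^-1| - m%:~R); split=> //.
  by rewrite -ltnS prednK// -lez_nat -mE.
right; rewrite prednK// mR subrK ltr0_norm ?invr_lt0//.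
by rewrite invrN invrK opprK.
Qed.

(** The excluded defects are those of the [v] in [D_cover], which is [p.2] on the positive side and
    [1 - p.2] on the negative one. *)
Definition regular_source : set (plane R) := [set p | [/\ D R r p, irrational p.1,
  irrational p.2, (0 < p.1 -> ~ selfdual_defect r p.2)
  & (p.1 < 0 -> ~ selfdual_defect r (1 - p.2))]].

(** Here [v] is the fractional part of [1/p.2]. Quantifying over all [k] avoids the floor: the
    defect set lies in []0, 1[], so only one [k] can matter. *)
Definition regular_target : set (plane R) := [set p | [/\ D R r p, irrational p.1,
  irrational p.2 & forall k : nat, ~ selfdual_defect r (p.2^-1 - k%:R)]].

Lemma D_snd01 x y : irrational x -> irrational y -> D R r (x, y) -> 0 < y < 1.
Proof.
move=> ix iy /(D_snd hr ix)/andP[y0 y1]; have [b0 _ _ _] := @beta_prop R r hr.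
apply/andP; split; last by lra.
rewrite lt_neqAle y0 andbT; apply/eqP => yE.
by apply: (irrational_neq (q := 0) iy); rewrite rmorph0.
Qed.

Lemma regular_source_expansion p : regular_source p -> exists k x' v,
  [/\ (1 <= k)%N, irrational x' /\ in_dom r x', irrational v /\ 0 < v < 1,
      ~ selfdual_defect r v &
      p = ((x' + k%:R)^-1, v) \/ p = (- (x' + k.+1%:R)^-1, 1 - v)].
Proof.
case: p => x y [/= Dp ix iy dp dn].
have y01 := D_snd01 ix iy Dp; have xd := in_dom_D hr ix Dp.
have [k [x' [k1 ix' xd' xE]]] := T_expansion ix xd.
exists k, x'; case: xE => xE.
  exists y; split=> //; last by left; rewrite xE.
  by apply: dp; rewrite xE; have [_] := Tbar_pos y xd' k1.
have iy' : irrational (1 - y).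
  by have := @irrationalDn R 1 _ (irrationalN iy); rewrite mulr1n.
exists (1 - y); split=> //.
- by split=> //; lra.
- by apply: dn; rewrite xE; exact: (Tbar_neg y xd' k1).2.
- by right; rewrite -xE (_ : 1 - (1 - y) = y)//; ring.
Qed.

Lemma nat_frac_inj (k l : nat) (u v : R) : 0 < u < 1 -> 0 < v < 1 ->
  k%:R + u = l%:R + v -> k = l /\ u = v.
Proof.
move=> u01 v01 E; have [kl|kl|kl] := ltngtP k l.
- have : (k.+1%:R : R) <= l%:R by rewrite ler_nat.
  by rewrite -natr1; lra.
- have : (l.+1%:R : R) <= k%:R by rewrite ler_nat.
  by rewrite -natr1; lra.
- by split=> //; move: E; rewrite kl; lra.
Qed.

Lemma Tbar_regular_source : set_bij regular_source regular_target (Tbar alpha).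
Proof.
split.
- move=> p X1p.
  have [k [x' [v [k1 [ix' xd'] [iv v01] nd pE]]]] := regular_source_expansion X1p.
  have [ac bc _ _] := D_cover hr ix' xd' iv v01 k1.
  have -> : Tbar alpha p = (x', (k%:R + v)^-1).
    by case: pE => ->; [have [] := Tbar_pos v xd' k1|have [] := Tbar_neg v xd' k1].
  split=> /=.
  + by case: X1p => Dp _ _ _ _; case: pE Dp => -> ?; [exact: ac|exact: bc].
  + exact: ix'.
  + by apply: irrationalV; exact: irrationalDn.
  + move=> l; rewrite invrK => dl; have [_ l01 _] := dl.
    have E : l%:R + (k%:R + v - l%:R) = k%:R + v by ring.
    by have [_ vE] := nat_frac_inj l01 v01 E; apply: nd; rewrite -vE.
- move=> p q /set_mem X1p /set_mem X1q.
  have [k [x' [v [k1 [ix' xd'] [iv v01] nd pE]]]] := regular_source_expansion X1p.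
  have [l [z' [w [l1 [iz' zd'] [iw w01] nd' qE]]]] := regular_source_expansion X1q.
  have [_ _ _ ab] := D_cover hr ix' xd' iv v01 k1.
  have -> : Tbar alpha p = (x', (k%:R + v)^-1).
    by case: pE => ->; [have [] := Tbar_pos v xd' k1|have [] := Tbar_neg v xd' k1].
  have -> : Tbar alpha q = (z', (l%:R + w)^-1).
    by case: qE => ->; [have [] := Tbar_pos w zd' l1|have [] := Tbar_neg w zd' l1].
  move=> [xz /invr_inj/(nat_frac_inj v01 w01)[kl vw]]; subst z' l w.
  case: X1p X1q => Dp _ _ _ _ [Dq _ _ _ _].
  (* Equal images force equal [k], [x'] and [v]; two distinct points would then be the two
     candidates, both in [D]. *)
  case: pE qE Dp Dq => -> [] -> // Dp Dq; exfalso; apply: nd; exact: ab.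
- move=> [x' y'] [/= Dp ix' iy' nd].
  have [k [v [k1 iv v01 yE]]] := gauss_expansion iy' (D_snd01 ix' iy' Dp).
  have xd' := in_dom_D hr ix' Dp.
  have ndv : ~ selfdual_defect r v by have := nd k; rewrite yE invrK addrAC subrr add0r.
  have [_ _ cab _] := D_cover hr ix' xd' iv v01 k1.
  have [Tp p0] := Tbar_pos v xd' k1; have [Tn n0] := Tbar_neg v xd' k1.
  move: Dp; rewrite yE => Dp; case: (cab Dp ndv) => Dq.
    exists ((x' + k%:R)^-1, v) => //; split=> //=.
    + by apply: irrationalV; rewrite addrC; exact: irrationalDn.
    + by move=> /(lt_trans p0); rewrite ltxx.
  exists (- (x' + k.+1%:R)^-1, 1 - v) => //; split=> //=.
  + by apply/irrationalN/irrationalV; rewrite addrC; exact: irrationalDn.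
  + by have := @irrationalDn R 1 _ (irrationalN iv); rewrite mulr1n.
  + by move=> /(lt_trans n0); rewrite ltxx.
  + by have -> : 1 - (1 - v) = v by ring.
Qed.

End Bijection.

(** * Invariance of the density *)

Section Domain.
Context {R : realType} (r : nat).

Local Notation mu := (@lebesgue_measure R).
Local Notation mu2 := (lebesgue2 R).
Local Notation alpha := (r%:R^-1 : R).

Lemma measurable_Bsym s : measurable (Bsym R r s).
Proof. by rewrite BsymE; case: s => *; exact: measurable_Cset. Qed.

Lemma measurable_rect (A B : set R) : measurable A -> measurable B ->
  measurable (A `*` B : set (plane R)).
Proof. by move=> mA mB; apply: measurableX. Qed.

Lemma measurable_D : measurable (D R r : set (plane R)).
Proof.
have mi (i : interval R) : measurable [set` i] by exact: measurable_itv.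
apply: measurableD.
  apply: measurableU; last exact: (measurable_rect (mi _) (mi _)).
  by apply: bigcup_measurable => i _; exact: (measurable_rect (mi _) (mi _)).
apply: measurableU.
  apply: measurableU.
    by apply: bigcup_measurable => i _; exact: (measurable_rect (mi _) (measurable_Bsym _)).
  exact: (measurable_rect (mi _) (measurable_Bsym _)).
exact: (measurable_rect (mi _) (measurable_Bsym _)).
Qed.

Lemma measurable_preimage (f : plane R -> R) (A : set R) :
  measurable_fun setT f -> measurable A -> measurable (f @^-1` A : set (plane R)).
Proof. by move=> mf mA; rewrite -[X in measurable X]setTI; apply: mf. Qed.

Lemma measurable_regular_source : measurable (@regular_source R r).
Proof.
pose dr := (@selfdual_defect R r).
have md : measurable dr by exact: measurable_selfdual_defect.
have m1 := @measurable_fst_plane R; have m2 := @measurable_snd_plane R.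
have mo : measurable_fun setT (fun p : plane R => 1 - p.2) by exact: measurable_funB.
have mirr := @measurable_irrational R.
have -> : @regular_source R r = D R r `&` ((fun p : plane R => p.1) @^-1` irrational) `&`
  ((fun p : plane R => p.2) @^-1` irrational) `&`
  ((fun p : plane R => p.1) @^-1` (~` (`]0, +oo[%classic : set R)) `|`
   (fun p : plane R => p.2) @^-1` (~` dr)) `&`
  ((fun p : plane R => p.1) @^-1` (~` (`]-oo, 0[%classic : set R)) `|`
   (fun p : plane R => 1 - p.2) @^-1` (~` dr)).
  apply/seteqP; split=> p; rewrite /regular_source /= !in_itv/= !andbT.
    move=> [Dp i1 i2 h1 h2]; split; first split => //.
      by have [/h1|] := pselect (0 < p.1); [right|left].
    by have [/h2|] := pselect (p.1 < 0); [right|left].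
  by move=> [[[[Dp i1] i2] h1] h2]; split=> // h; [case: h1|case: h2].
apply: measurableI; last first.
  by apply: measurableU; apply: measurable_preimage => //; apply: measurableC => //; exact: measurable_itv.
apply: measurableI; last first.
  by apply: measurableU; apply: measurable_preimage => //; apply: measurableC => //; exact: measurable_itv.
by do 2?[apply: measurableI; last exact: measurable_preimage]; exact: measurable_D.
Qed.

Lemma measurable_regular_target : measurable (@regular_target R r).
Proof.
pose dr := (@selfdual_defect R r).
have md : measurable dr by exact: measurable_selfdual_defect.
have m1 := @measurable_fst_plane R; have m2 := @measurable_snd_plane R.
have mo (k : nat) : measurable_fun setT (fun p : plane R => p.2^-1 - k%:R).
  by apply: measurable_funB => //; exact: (measurableT_comp measurable_inv m2).
have mirr := @measurable_irrational R.
have -> : @regular_target R r = D R r `&` ((fun p : plane R => p.1) @^-1` irrational) `&`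
  ((fun p : plane R => p.2) @^-1` irrational) `&`
  \bigcap_k ((fun p : plane R => p.2^-1 - k%:R) @^-1` (~` dr)).
  apply/seteqP; split=> p; rewrite /regular_target /=.
    by move=> [Dp i1 i2 h]; split => // k _; exact: h.
  by move=> [[[Dp i1] i2] h]; split=> // k; exact: h.
apply: measurableI; last first.
  by apply: bigcap_measurable => // k _; apply: measurable_preimage => //; exact: measurableC.
by do 2?[apply: measurableI; last exact: measurable_preimage]; exact: measurable_D.
Qed.

Lemma lebesgue2_strip_null (A : set R) : measurable A -> mu A = 0%E ->
  mu2 (A `*` setT) = 0%E /\ mu2 (setT `*` A) = 0%E.
Proof.
move=> mA A0; split.
  have -> : mu2 (A `*` setT) = (mu A * mu setT)%E by exact: product_measure1E.
  by rewrite A0 mul0e.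
have -> : mu2 (setT `*` A) = (mu setT * mu A)%E by exact: product_measure1E.
by rewrite A0 mule0.
Qed.

Lemma lebesgue_rational : mu (@rational R) = 0%E.
Proof.
by apply: countable_lebesgue_measure0; exact: (card_le_trans (card_image_le _ _) (countableP _)).
Qed.

Lemma measurable_rational : measurable (@rational R).
Proof. by rewrite -(setCK rational); apply: measurableC; exact: measurable_irrational. Qed.

Lemma D_diff_regular_source : (3 <= r)%N -> mu2 (D R r `\` regular_source r) = 0%E.
Proof.
move=> hr; pose dr := (@selfdual_defect R r).
have md : measurable dr by exact: measurable_selfdual_defect.
have d0 : mu dr = 0%E by exact: selfdual_defect_null.
pose dr' : set R := (fun y => 1 - y) @^-1` dr.
have mo : measurable_fun setT (fun y : R => 1 - y) by exact: measurable_funB.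
have md' : measurable dr' by rewrite -[X in measurable X]setTI; exact: mo.
have d'0 : mu dr' = 0%E.
  have mdr : measurable_fun setT (\1_dr : R -> R) by exact: measurable_indic.
  have mi : measurable_fun setT (EFin \o (\1_dr : R -> R)).
    by apply/measurable_EFinP.
  have i0 y : (0 <= (EFin \o (\1_dr : R -> R)) y)%E by rewrite lee_fin.
  rewrite -(setIT dr') -integral_indic//.
  transitivity (\int[mu]_y ((\1_dr : R -> R) (1 - y))%:E)%E.
    by apply: eq_integral => y _; rewrite !indicE; congr (_%:R)%:E;
      apply/idP/idP => /set_mem ?; exact/mem_set.
  transitivity (\int[mu]_y ((\1_dr : R -> R) (1 + y))%:E)%E.
    rewrite (ge0_integral_opp (f := fun y => ((\1_dr : R -> R) (1 + y))%:E))//.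
    - apply/measurable_EFinP; apply: (measurableT_comp mdr).
      exact: measurable_funD.
  transitivity (\int[mu]_y ((\1_dr : R -> R) (y + 1))%:E)%E.
    by apply: eq_integral => y _; rewrite addrC.
  rewrite -(ge0_integral_shift 1 mi i0).
  by rewrite [LHS]integral_indic// setIT.
apply/eqP; rewrite eq_le measure_ge0 andbT.
pose N := ((@rational R `*` setT) `|` (setT `*` @rational R)) `|`
          ((setT `*` dr) `|` (setT `*` dr')).
have mT : measurable (@setT R) by [].
have mN1 := measurable_rect measurable_rational mT.
have mN2 := measurable_rect mT measurable_rational.
have mN3 := measurable_rect mT md.
have mN4 := measurable_rect mT md'.
have N0 : mu2 N = 0%E.
  have [r1 r2] := lebesgue2_strip_null measurable_rational lebesgue_rational.
  have [_ r3] := lebesgue2_strip_null md d0.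
  have [_ r4] := lebesgue2_strip_null md' d'0.
  by do 3?[rewrite measureU0//]; do ?apply: measurableU => //; rewrite measureU0.
rewrite -N0; apply: le_measure; rewrite ?inE.
- by apply: measurableD; [exact: measurable_D|exact: measurable_regular_source].
- by do ?apply: measurableU.
move=> [x y] [Dp nX]; apply: contrapT => nN; apply: nX.
split=> //=.
- by move=> rx; apply: nN; left; left.
- by move=> ry; apply: nN; left; right.
- by move=> _ dy; apply: nN; right; left.
- by move=> _ dy; apply: nN; right; right.
Qed.

End Domain.

Section Invariance.
Context {R : realType} (r : nat) (hr : (3 <= r)%N).

Local Notation mu := (@lebesgue_measure R).
Local Notation mu2 := (lebesgue2 R).
Local Notation alpha := (r%:R^-1 : R).
Local Notation S := (Tbar alpha : plane R -> plane R).
Local Notation regular_source := (@regular_source R r).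
Local Notation regular_target := (@regular_target R r).
Local Notation DD := (D R r : set (plane R)).

Lemma regular_source_bounds (p : plane R) : regular_source p ->
  [/\ in_dom r (p.1 : R), 0 < (p.2 : R) < 1 & alpha < (p.1 : R) * p.2 + 1 < 2].
Proof.
case: p => x y [/= Dp ix iy _ _]; have xd := in_dom_D hr ix Dp.
have y01 := D_snd01 hr ix iy Dp; split=> //.
have [a0 a1 _ _] := @alpha_bounds R r hr.
by move: xd; rewrite /in_dom => xd; apply/andP; split; nra.
Qed.

Lemma kappa_null (A : set (plane R)) : measurable A -> mu2 A = 0%E -> kappa A = 0%E.
Proof.
move=> mA A0; rewrite kappaE null_set_integral//.
by apply/measurable_EFinP; apply: measurable_funTS; exact: measurable_kappa0.
Qed.

(** Since [1/r < x y + 1 < 2], the density lies between 1/4 and [r^2]; so null sets can be passed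
    from either measure to the other. *)
Lemma kappa_bounds (A : set (plane R)) : measurable A -> A `<=` regular_source ->
  (mu2 A <= 4%:E * kappa A)%E /\ (kappa A < +oo)%E.
Proof.
move=> mA AX; have [a0 a1 aE r3] := @alpha_bounds R r hr.
have mk : measurable_fun A (EFin \o (@kappa0 R)).
  by apply/measurable_EFinP; apply: measurable_funTS; exact: measurable_kappa0.
split.
  rewrite kappaE -ge0_integralZl//; last by move=> p _; rewrite lee_fin kappa0_ge0.
  rewrite -[X in (X <= _)%E]mul1e -integral_cst//.
  apply: ge0_le_integral => //.
  - exact: emeasurable_funM.
  move=> p /AX/regular_source_bounds[_ _ p12]; rewrite -EFinM lee_fin /kappa0.
  rewrite -[4]invrK -invfM invf_ge1.
    by nra.
  by nra.
rewrite kappaE; apply: (@le_lt_trans _ _ (\int[mu2]_(p in A) (r%:R ^+ 2)%:E)%E).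
  apply: ge0_le_integral => //.
  - by move=> p _; rewrite lee_fin kappa0_ge0.
  move=> p /AX/regular_source_bounds[_ _ /andP[p1 p2]]; rewrite lee_fin /kappa0.
  rewrite -[leRHS]invrK lef_pV2 ?posrE.
  - by rewrite -exprVn ler_sqr ?nnegrE; lra.
  - by rewrite exprn_gt0; lra.
  - by rewrite invr_gt0 exprn_gt0; lra.
rewrite integral_cst//.
pose box : set (plane R) := (`[(-1), 1] `*` `[0, 1])%classic.
have AB : (mu2 A <= mu2 box)%E.
  apply: le_measure; rewrite ?inE//.
    by apply: measurable_rect; exact: measurable_itv.
  move=> p /AX/regular_source_bounds[+ /andP[y0 y1] _]; rewrite /in_dom => xd.
  by split; rewrite /= in_itv/=; [lra|rewrite (ltW y0) (ltW y1)].
apply: (@le_lt_trans _ _ ((r%:R ^+ 2)%:E * mu2 box)%E).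
  by apply: lee_wpmul2l => //; rewrite lee_fin sqr_ge0.
have -> : (mu2 box = mu `[(-1)%R, 1%R] * mu `[0%R, 1%R])%E.
  by apply: product_measure1E; exact: measurable_itv.
rewrite !lebesgue_measure_itv/= !lte_fin.
by case: ifP => _; case: ifP => _; rewrite ?mule0 ?mul0e ?mule0 -?EFinB -?EFinM ltry.
Qed.

(** One natural number encodes a branch: its parity the sign of [x], its half the value of [k_]. *)
Definition piece (n : nat) : set (plane R) :=
  [set p | (if odd n then p.1 < 0 else 0 < p.1) /\ k_ alpha p.1 = n./2%:Z].

Definition piece_sign (n : nat) : R := if odd n then -1 else 1.

Lemma piece_sign_norm n : `|piece_sign n| = 1.
Proof. by rewrite /piece_sign; case: odd; rewrite ?normrN1 ?normr1. Qed.

Lemma Tbar_piece n p : piece n p -> S p = branch (piece_sign n) n./2%:R p.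
Proof.
case: p => x y; rewrite /piece /piece_sign /branch /Tbar /T_ /= => -[].
case: odd => x0 ->; rewrite -pmulrn.
  by rewrite ltr0_norm ?invr_lt0// ltr0_sg// !mulN1r.
by rewrite gtr0_norm ?invr_gt0// gtr0_sg// !mul1r.
Qed.

Lemma measurable_k : measurable_fun setT (fun x : R => (k_ alpha x)%:~R : R).
Proof.
have mf : measurable_fun setT (fun z : R => (Num.floor z)%:~R : R).
  apply: nondecreasing_measurable => // x y xy.
  by rewrite ler_int le_floor.
apply: (measurableT_comp mf); apply: measurable_funB => //.
apply: measurable_funD => //.
exact: (measurableT_comp (@normr_measurable R setT) measurable_inv).
Qed.

Lemma measurable_T : measurable_fun setT (fun x : R => T_ alpha x).
Proof.
apply: measurable_funB; last exact: measurable_k.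
exact: (measurableT_comp (@normr_measurable R setT) measurable_inv).
Qed.

Lemma measurable_sg : measurable_fun setT (@Num.sg R).
Proof.
apply: nondecreasing_measurable => // x y xy.
by case: (sgrP x) xy; case: (sgrP y) => // *; lra.
Qed.

Lemma measurable_Tbar : measurable_fun setT S.
Proof.
have m1 := @measurable_fst_plane R; have m2 := @measurable_snd_plane R.
rewrite /Tbar; apply: measurable_pair_plane.
  exact: (measurableT_comp measurable_T m1).
apply: (measurableT_comp measurable_inv); apply: measurable_funD.
  exact: (measurableT_comp measurable_k m1).
by apply: measurable_funM => //; exact: (measurableT_comp measurable_sg m1).
Qed.

Lemma measurable_piece n : measurable (piece n).
Proof.
have m1 := @measurable_fst_plane R.
have -> : piece n =
    (fun p : plane R => p.1) @^-1` (if odd n then `]-oo, 0[%classic else `]0, +oo[%classic : set R)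
    `&` (fun p : plane R => (k_ alpha p.1)%:~R) @^-1` [set n./2%:R : R].
  apply/seteqP; split=> p; rewrite /piece /=.
    by move=> [p0 ->]; split=> //; move: p0; case: odd; rewrite /= in_itv/= ?andbT.
  move=> [p0 /eqP kE]; split.
    by move: p0; case: odd; rewrite /= in_itv/= ?andbT.
  by move: kE; rewrite (pmulrn 1 n./2) eqr_int => /eqP.
apply: measurableI; apply: measurable_preimage => //.
- by case: odd; exact: measurable_itv.
- exact: (measurableT_comp measurable_k m1).
Qed.

Lemma piece_cover p : regular_source p -> exists n, piece n p.
Proof.
move=> X1p; have [k [x' [v [k1 [ix' xd'] [iv v01] nd pE]]]] := regular_source_expansion hr X1p.
have oE (b : bool) (m : nat) : odd (b + m.*2) = b by rewrite oddD odd_double addbF oddb.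
case: pE => ->.
  have [_ x0] := Tbar_pos hr v xd' k1; exists (false + k.*2)%N.
  rewrite /piece oE half_bit_double; split=> //; apply: (@k_E _ r _ x' k) => //.
  by rewrite /= invrK ger0_norm//; move: x0; rewrite invr_gt0 => /ltW.
have [_ x0] := Tbar_neg hr v xd' k1; exists (true + k.+1.*2)%N.
rewrite /piece oE half_bit_double; split=> //; apply: (@k_E _ r _ x' k.+1) => //.
rewrite /= invrN invrK normrN ger0_norm//.
by move: x0; rewrite oppr_lt0 invr_gt0 => /ltW.
Qed.

Lemma piece_trivIset : trivIset setT piece.
Proof.
move=> n m _ _ [p [[pn kn] [pm km]]].
have hE : n./2 = m./2 by apply/eqP; rewrite -eqz_nat -kn km.
have oE : odd n = odd m.
  by case: (odd n) (odd m) pn pm => [] [] // h1 h2; have := lt_trans h1 h2; rewrite ltxx.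
by rewrite -(odd_double_half n) -(odd_double_half m) hE oE.
Qed.

(** Each piece is moved by a single branch, and injectivity on [regular_source] keeps the images
    disjoint, so the measures add up. *)
Lemma image_Tbar (A : set (plane R)) : measurable A -> A `<=` regular_source ->
  measurable (S @` A) /\ kappa (S @` A) = kappa A.
Proof.
move=> mA AX; pose F n := A `&` piece n.
have AE : A = \bigcup_n F n.
  apply/seteqP; split=> [p Ap|p [n _ []]//].
  by have [n pn] := piece_cover (AX _ Ap); exists n.
have mF n : measurable (F n) by apply: measurableI => //; exact: measurable_piece.
have SFE n : S @` F n = branch (piece_sign n) n./2%:R @` F n.
  by apply: eq_imagel => p [_]; exact: Tbar_piece.
have SF n : measurable (S @` F n) /\ kappa (S @` F n) = kappa (F n).
  rewrite SFE; apply: kappa_branch => //; first exact: piece_sign_norm.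
  move=> p [Ap pn]; have [_ ip1 ip2 _ _] := AX _ Ap; split.
    by apply/eqP => pE; apply: (irrational_neq (q := 0) ip1); rewrite rmorph0.
  apply/eqP => pE; apply: (irrational_neq (q := (if odd n then n./2%:R else - n./2%:R)) ip2).
  move: pE; rewrite /piece_sign; case: odd; rewrite ?rmorphN/= ratr_nat; lra.
have SAE : S @` A = \bigcup_n (S @` F n) by rewrite [in LHS]AE image_bigcup.
have tF : trivIset setT F by apply: trivIset_setIl; exact: piece_trivIset.
have tSF : trivIset setT (fun n => S @` F n).
  move=> n m _ _ [_ [[p Fp <-] [q Fq]]] /(set_bij_inj (Tbar_regular_source hr)) pq.
  apply: (tF n m) => //; exists p; split=> //; rewrite -pq ?inE//; apply: AX.
    by case: Fq.
  by case: Fp.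
split; first by rewrite SAE; apply: bigcupT_measurable => n; have [] := SF n.
rewrite SAE [in RHS]AE !measure_bigcup//; last by move=> n _; have [] := SF n.
by apply: eq_eseriesr => n _; have [] := SF n.
Qed.

End Invariance.

(** * An invariant set of full measure *)

Section Core.
Context {R : realType} (r : nat) (hr : (3 <= r)%N).

Local Notation mu := (@lebesgue_measure R).
Local Notation mu2 := (lebesgue2 R).
Local Notation alpha := (r%:R^-1 : R).
Local Notation S := (Tbar alpha : plane R -> plane R).
Local Notation regular_source := (@regular_source R r : set (plane R)).
Local Notation regular_target := (@regular_target R r : set (plane R)).
Local Notation DD := (D R r : set (plane R)).

Lemma regular_source_sub_D : regular_source `<=` DD. Proof. by move=> p []. Qed.
Lemma regular_target_sub_D : regular_target `<=` DD. Proof. by move=> p []. Qed.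

Lemma kappa_sub_null (A B : set (plane R)) : measurable A -> measurable B ->
  A `<=` B -> kappa B = 0%E -> kappa A = 0%E.
Proof.
move=> mA mB AB B0; apply/eqP; rewrite eq_le measure_ge0 andbT -B0.
by apply: le_measure; rewrite ?inE.
Qed.

Lemma kappa_setU_null (A B : set (plane R)) : measurable A -> measurable B ->
  kappa A = 0%E -> kappa B = 0%E -> kappa (A `|` B) = 0%E.
Proof. by move=> mA mB A0 B0; rewrite measureU0. Qed.

Lemma kappa_D : kappa DD = kappa regular_source.
Proof.
have mD := @measurable_D R r; have mX := @measurable_regular_source R r.
have DE : DD = regular_source `|` (DD `\` regular_source).
  apply/seteqP; split=> [p Dp|p [/regular_source_sub_D//|[]//]].
  by have [?|?] := pselect (regular_source p); [left|right].
rewrite [in LHS]DE measureU0//; first exact: measurableD.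
by apply: kappa_null; [exact: measurableD|exact: D_diff_regular_source].
Qed.

Lemma kappa_D_lty : (kappa DD < +oo)%E.
Proof.
rewrite kappa_D; have [] := @kappa_bounds R r hr regular_source (measurable_regular_source _) => //.
Qed.

(** A counting argument: [regular_target] is the image of [regular_source], hence has the same
    measure, which is that of [DD] and is finite. *)
Lemma kappa_D_diff_regular_target : kappa (DD `\` regular_target) = 0%E.
Proof.
have mD := @measurable_D R r; have mX2 := @measurable_regular_target R r.
have X2E : S @` regular_source = regular_target.
  have [SX _ sX] := @Tbar_regular_source R r hr.
  by apply/seteqP; split=> [_ [p X1p <-]|z Xz]; [exact: SX|exact: sX].
have [_ kX] := @image_Tbar R r hr regular_source (measurable_regular_source _) (@subset_refl _ _).
rewrite measureD//; last exact: kappa_D_lty.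
rewrite setIidr; last exact: regular_target_sub_D.
transitivity (kappa DD - kappa regular_target)%E => //.
rewrite -X2E kX kappa_D subee// ge0_fin_numE//.
by rewrite -kappa_D; exact: kappa_D_lty.
Qed.

(** Images and preimages are taken only within [regular_source] and [regular_target], where the map
    is a [kappa]-preserving bijection, so every stage stays null. *)
Fixpoint saturation (n : nat) : set (plane R) :=
  if n is m.+1 then saturation m `|` S @` (saturation m `&` regular_source)
    `|` (regular_source `&` S @^-1` (saturation m `&` regular_target))
  else (DD `\` regular_source) `|` (DD `\` regular_target).

Lemma saturation_null n : measurable (saturation n) /\ kappa (saturation n) = 0%E.
Proof.
have mD := @measurable_D R r.
have mX1 := @measurable_regular_source R r; have mX2 := @measurable_regular_target R r.
elim: n => [|n [mU U0]] /=.
  have m1 : measurable (DD `\` regular_source) by exact: measurableD.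
  have m2 : measurable (DD `\` regular_target) by exact: measurableD.
  split; first exact: measurableU.
  apply: kappa_setU_null => //; last exact: kappa_D_diff_regular_target.
  by apply: kappa_null => //; exact: D_diff_regular_source.
have mU1 : measurable (saturation n `&` regular_source) by exact: measurableI.
have mU2 : measurable (saturation n `&` regular_target) by exact: measurableI.
have [mS kS] := image_Tbar hr mU1 (@subIsetr _ _ _).
have mP : measurable (regular_source `&` S @^-1` (saturation n `&` regular_target)).
  apply: measurableI => //; rewrite -[X in measurable X]setTI.
  exact: (measurable_Tbar r).
have [mSP kSP] := image_Tbar hr mP (@subIsetl _ _ _).
split; first by do 2?apply: measurableU.
apply: kappa_setU_null => //; first exact: measurableU.
  apply: kappa_setU_null => //; rewrite kS.
  by apply: kappa_sub_null U0 => //; exact: subIsetl.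
(* The preimage is measured through its image, which lies in the previous stage. *)
rewrite -kSP; apply: kappa_sub_null U0 => //.
by move=> _ [p [_ [? _]] <-].
Qed.

Definition core : set (plane R) := DD `\` \bigcup_n saturation n.

Lemma measurable_core : measurable core.
Proof.
apply: measurableD; first exact: measurable_D.
by apply: bigcupT_measurable => n; have [] := saturation_null n.
Qed.

Lemma core_regular_source : core `<=` regular_source.
Proof.
move=> p [Dp nU]; apply: contrapT => np; apply: nU.
by exists 0%N => //; left; split.
Qed.

Lemma core_regular_target : core `<=` regular_target.
Proof.
move=> p [Dp nU]; apply: contrapT => np; apply: nU.
by exists 0%N => //; right; split.
Qed.

(** A point whose image falls into some stage belongs to the next one, and likewise for preimages;
    so neither direction leaves [core]. *)
Lemma core_bij : set_bij core core S.
Proof.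
have [S12 Sinj Ssurj] := @Tbar_regular_source R r hr.
split.
- move=> p cp; have X1p := core_regular_source cp; have X2S := S12 _ X1p; split.
    exact: regular_target_sub_D.
  move=> [n _ Un]; case: cp => _; apply; exists n.+1 => //; right.
  by split.
- move=> p q /set_mem cp /set_mem cq; apply: Sinj; apply/mem_set; exact: core_regular_source.
- move=> z cz; have [p X1p pz] := Ssurj _ (core_regular_target cz); exists p => //; split.
    exact: regular_source_sub_D.
  move=> [n _ Un]; case: cz => _; apply; exists n.+1 => //; left; right.
  by exists p => //; split.
Qed.

Lemma core_conull : mu2 (DD `\` core) = 0%E.
Proof.
have mD := @measurable_D R r; have mX1 := @measurable_regular_source R r.
have mU : measurable (\bigcup_n saturation n).
  by apply: bigcupT_measurable => n; have [] := saturation_null n.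
pose N := regular_source `&` \bigcup_n saturation n.
have mN : measurable N by exact: measurableI.
have N0 : mu2 N = 0%E.
  have [N4 _] := kappa_bounds hr mN (@subIsetl _ _ _).
  apply/eqP; rewrite eq_le measure_ge0 andbT (le_trans N4)//.
  suff -> : kappa N = 0%E by rewrite mule0.
  apply: (@kappa_sub_null _ (\bigcup_n saturation n)) => //; first exact: subIsetr.
  apply/eqP; rewrite eq_le measure_ge0 andbT.
  have ms n : measurable (saturation n) by have [] := saturation_null n.
  apply: (le_trans (generalized_Boole_inequality kappa ms mU)).
  by rewrite eseries0// => n _ _; have [] := saturation_null n.
apply/eqP; rewrite eq_le measure_ge0 andbT.
have <- : mu2 ((DD `\` regular_source) `|` N) = 0%E.
  by rewrite measureU0//; [exact: D_diff_regular_source|exact: measurableD].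
apply: le_measure; rewrite ?inE.
- by apply: measurableD => //; exact: measurable_core.
- by apply: measurableU => //; exact: measurableD.
move=> p [Dp nc]; have [X1p|nX1] := pselect (regular_source p); last by left.
by right; split=> //; apply: contrapT => nU; apply: nc.
Qed.

(** The irrational points of the square of side [1/r] all lie in [D]: [y < 1/r] has first quotient
    at least [r], where [fiber_pos] has no holes. *)
Lemma kappa_D_gt0 : (0 < kappa DD)%E.
Proof.
have mD := @measurable_D R r; have mX1 := @measurable_regular_source R r.
have [a0 a1 aE r3] := @alpha_bounds R r hr.
rewrite lt_neqAle measure_ge0 andbT; apply/negP => /eqP k0.
pose A : set R := `]0, alpha[%classic `&` irrational.
have mi : measurable (`]0, alpha[%classic : set R) by exact: measurable_itv.
have mirr := @measurable_irrational R.
have mrat := @measurable_rational R.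
have mA : measurable A by exact: measurableI.
have muA : mu A = alpha%:E.
  transitivity (mu `]0, alpha[%classic); last first.
    by rewrite lebesgue_measure_itv/= lte_fin a0 oppr0 addr0.
  have -> : (`]0, alpha[%classic : set R) = A `|` (`]0, alpha[%classic `&` rational).
    by rewrite -setIUr /irrational setUC setUv setIT.
  rewrite measureU0//; first exact: measurableI.
  apply/eqP; rewrite eq_le measure_ge0 andbT -(lebesgue_rational (R := R)).
  by apply: le_measure; rewrite ?inE//; exact: measurableI.
have mQ : measurable (A `*` A : set (plane R)) by exact: measurable_rect.
have QD : A `*` A `<=` DD.
  move=> [x y] [/= [+ _] [+ iy]]; rewrite /= !in_itv/= => x0 y0.
  rewrite D_pos//; have y01 : 0 < y < 1 by lra.
  have [k [v [k1 _ v01 yE]]] := gauss_expansion iy y01.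
  rewrite yE fiber_pos_gauss//; left.
  rewrite -ltnS -(ltr_nat R) -natr1.
  have kR0 : 0 <= k%:R :> R by [].
  suff : r%:R < k%:R + v by lra.
  by case/andP: y0 => _; rewrite yE ltf_pV2 ?posrE; lra.
have mQX : measurable ((A `*` A) `&` regular_source) by exact: measurableI.
have [QX4 _] := kappa_bounds hr mQX (@subIsetr _ _ _).
have QX0 : mu2 ((A `*` A) `&` regular_source) = 0%E.
  apply/eqP; rewrite eq_le measure_ge0 andbT (le_trans QX4)//.
  rewrite (@kappa_sub_null _ DD)// ?mule0//.
  by apply: subset_trans regular_source_sub_D; exact: subIsetr.
have Q0 : mu2 (A `*` A) = 0%E.
  apply/eqP; rewrite eq_le measure_ge0 andbT.
  have <- : mu2 (((A `*` A) `&` regular_source) `|` (DD `\` regular_source)) = 0%E.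
    rewrite measureU0//; first exact: measurableD.
    exact: D_diff_regular_source.
  apply: le_measure; rewrite ?inE//.
    by apply: measurableU => //; exact: measurableD.
  move=> p Qp; have [X1p|nX1] := pselect (regular_source p); [by left|right].
  by split=> //; exact: QD.
have QE : mu2 (A `*` A) = (mu A * mu A)%E by exact: product_measure1E.
move: Q0; rewrite QE muA -EFinM => -[/eqP]; rewrite mulf_eq0 => /orP[]; rewrite gt_eqF//.
Qed.

End Core.

(** * The past of a point determines it *)

Section Generation.
Context {R : realType} (r : nat) (hr : (3 <= r)%N).

Local Notation alpha := (r%:R^-1 : R).
Local Notation S := (Tbar alpha : plane R -> plane R).
Local Notation core := (@core R r : set (plane R)).

Definition past_sets : set (set (plane R)) := [set G | exists n F,
  measurable (F : set (measurableTypeR R)) /\ G = iter n S @` (core `&` fst @^-1` F)].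

Lemma D_snd_core p : core p -> 0 <= (p.2 : R) <= 1 - beta R r.
Proof.
move=> cp; have [Dp ip _ _ _] := core_regular_source cp; case: p cp Dp ip => x y cp Dp ip.
exact: (D_snd hr ip Dp).
Qed.

(** A general [t] is needed because the approximants of the second coordinate need not lie in a
    fiber. On the negative side [k_] is at least 2. *)
Lemma branch_denom_ge1 (p : plane R) (t : R) : regular_source r p -> 0 <= t <= 1 ->
  1 <= (k_ alpha (p.1 : R))%:~R + Num.sg (p.1 : R) * t.
Proof.
move=> X1p t01; have [k [x' [v [k1 [ix' xd'] [iv v01] nd pE]]]] := regular_source_expansion hr X1p.
have k1R : 1 <= k%:R :> R by rewrite ler1n.
case: pE => ->.
  have [_ x0] := Tbar_pos hr v xd' k1.
  rewrite (@k_E _ r _ x' k)//= ?gtr0_sg// -?pmulrn ?mul1r; first lra.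
  by rewrite invrK ger0_norm//; move: x0; rewrite invr_gt0 => /ltW.
have [_ x0] := Tbar_neg hr v xd' k1.
rewrite (@k_E _ r _ x' k.+1)//= ?ltr0_sg// -?pmulrn -?natr1; first lra.
rewrite invrN invrK normrN natr1 ger0_norm//.
by move: x0; rewrite oppr_lt0 invr_gt0 => /ltW.
Qed.

Section Inverse.
Variable Sinv : plane R -> plane R.
Hypothesis SinvP : forall z, core z -> core (Sinv z) /\ S (Sinv z) = z.

Let iter_core n z : core z -> core (iter n Sinv z).
Proof. by move=> cz; elim: n => //= n IH; have [] := SinvP IH. Qed.

Let iter_SK n z : core z -> iter n S (iter n Sinv z) = z.
Proof.
elim: n z => // n IH z cz; rewrite iterS [iter n.+1 Sinv z]iterSr.
have [cz' Sz'] := SinvP cz.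
by rewrite IH.
Qed.

Let iter_core_S n z : core z -> core (iter n S z).
Proof.
have [Sc _ _] := @core_bij R r hr.
by move=> cz; elim: n => //= n IH; exact: Sc.
Qed.

Let SinvK z : core z -> Sinv (S z) = z.
Proof.
have [Sc Si _] := @core_bij R r hr; move=> cz.
have [c1 c2] := SinvP (Sc _ cz).
by apply: Si => //; exact/mem_set.
Qed.

Let iter_SinvK n z : core z -> iter n Sinv (iter n S z) = z.
Proof.
elim: n z => // n IH z cz; rewrite [iter n.+1 S z]iterS iterSr SinvK ?IH//.
exact: iter_core_S.
Qed.

(** Extending the sigma-algebra from [core] to the whole plane by traces makes the closure
    properties of measurable functions available. *)
Let sys : set (set (plane R)) := [set A | <<s core, past_sets >> (core `&` A)].

Let sys_sigma : sigma_algebra setT sys.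
Proof.
have [s0 sC sU] := smallest_sigma_algebra core past_sets.
split; rewrite /sys /=.
- by rewrite setI0.
- move=> A sA; have -> : core `&` (setT `\` A) = core `\` (core `&` A).
    by rewrite setTD setDE setCI setIUr setICr set0U.
  exact: sC.
- by move=> F sF; rewrite setI_bigcupr; exact: sU.
Qed.

Let T' := g_sigma_algebraType sys.

Let measurable_sys (A : set T') : measurable A = sys A.
Proof. by rewrite -[in RHS](sigma_algebra_id sys_sigma). Qed.

Let past (n : nat) (z : T') : R := (iter n Sinv (z : plane R)).1.

(** Within [core], [past n z] lies in [F] exactly when [z] lies in the [n]-th image of the cylinder
    over [F], a generator. Nothing else about [Sinv] is used. *)
Let measurable_past n : measurable_fun setT (past n).
Proof.
move=> _ F mF; rewrite setTI measurable_sys /sys /=.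
apply: sub_sigma_algebra; exists n, F; split => //.
apply/seteqP; split=> z.
  move=> [cz Fz]; exists (iter n Sinv z); last exact: iter_SK.
  by split => //; exact: iter_core.
by move=> [p [cp Fp] <-]; split; [exact: iter_core_S|rewrite /past /= iter_SinvK].
Qed.

(** The continued fraction of the second coordinate of the [j]-th preimage, unrolled [m] steps
    further back and cut off with 0. It involves the past first coordinates only. *)
Fixpoint approx (m j : nat) (z : T') : R :=
  if m is m'.+1 then
    ((k_ alpha (past j.+1 z))%:~R + Num.sg (past j.+1 z) * approx m' j.+1 z)^-1
  else 0.

Let measurable_approx m j : measurable_fun setT (approx m j).
Proof.
elim: m j => [|m IH] j /=; first exact: measurable_cst.
apply: (measurableT_comp measurable_inv); apply: measurable_funD.
  exact: (measurableT_comp (measurable_k r) (measurable_past j.+1)).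
apply: measurable_funM => //.
exact: (measurableT_comp measurable_sg (measurable_past j.+1)).
Qed.

(* For v(t) = 1/(k + s t) one has |v(t) - v(y)| = |t - y| v(t) v(y), where
   v(t) <= 1, and v(y) <= 1 - beta because it is a second coordinate in D. *)
Let approx_error m j (z : plane R) : core z ->
  0 <= approx m j z <= 1 /\
  `|approx m j z - (iter j Sinv z).2| <= (1 - beta R r) ^+ m.
Proof.
move=> cz; have [b0 b1 _ _] := @beta_prop R r hr.
elim: m j => [|m IH] j.
  have := D_snd_core (iter_core j cz); rewrite /= sub0r normrN expr0 => yb.
  by rewrite lexx ler01 ger0_norm; lra.
have [a01 aE] := IH j.+1; rewrite /= in aE *.
have cj := iter_core j cz; have [cj1 SE] := SinvP cj.
set p := Sinv _ in cj1 SE aE *; have yb := D_snd_core cj; have pb := D_snd_core cj1.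
have yE : (iter j Sinv z).2 = ((k_ alpha (p.1 : R))%:~R + Num.sg (p.1 : R) * p.2)^-1.
  by rewrite -SE.
have p01 : 0 <= (p.2 : R) <= 1 by lra.
have h1 := branch_denom_ge1 (core_regular_source cj1) a01.
have h2 := branch_denom_ge1 (core_regular_source cj1) p01.
rewrite yE in yb *; rewrite /past /=.
set K := (k_ _ _)%:~R in h1 h2 yb *; set s := Num.sg _ in h1 h2 yb *.
have s1 : `|s| <= 1 by rewrite normr_sg; case: (_ != _).
set t := approx _ _ _ in a01 aE h1 *; set y : R := p.2 in pb p01 h2 aE yb *.
have inv_le : (K + s * t)^-1 <= 1 by rewrite invf_le1; lra.
have inv_ge : 0 <= (K + s * t)^-1 by rewrite invr_ge0; lra.
split; first by rewrite inv_ge.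
have -> : (K + s * t)^-1 - (K + s * y)^-1 =
    (K + s * t)^-1 * (K + s * y)^-1 * (s * (y - t)).
  by field; apply/andP; split; apply/eqP; lra.
rewrite !normrM exprS (ger0_norm inv_ge) (ger0_norm (x := (K + s * y)^-1)); last by case/andP: yb.
rewrite distrC in aE.
apply: ler_pM; rewrite ?mulr_ge0//; first by case/andP: yb.
  rewrite -[leRHS]mul1r; apply: ler_pM => //; by case/andP: yb.
by rewrite -[leRHS]mul1r; apply: ler_pM.
Qed.

Let approx_cvg (z : plane R) : core z -> approx m 0 z @[m --> \oo] --> (z.2 : R).
Proof.
move=> cz; have [b0 b1 _ _] := @beta_prop R r hr.
have cb : `|1 - beta R r| < 1 by rewrite ger0_norm; lra.
have /cvgr0Pnorm_le c0 := cvg_expr cb.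
apply/cvgrPdist_le => e e0; near=> m.
have [_ ae] := approx_error m 0 cz; rewrite distrC (le_trans ae)//.
rewrite -[leLHS]ger0_norm ?exprn_ge0//; last by lra.
by near: m; exact: c0.
Unshelve. all: by end_near. Qed.

Lemma core_generated_of_inverse (A : set (plane R)) : measurable A ->
  <<s core, past_sets >> (core `&` A).
Proof.
move=> mA.
have mc : measurable (core : set T').
  rewrite measurable_sys /sys /= setIid.
  have [s0 sC _] := smallest_sigma_algebra core past_sets.
  by have := sC _ s0; rewrite setD0.
have m1c : measurable_fun setT (\1_(core : set T') : T' -> R) by exact: measurable_indic.
(* The approximants converge on [core] only; the indicator makes the limit hold everywhere, as the
   closure of measurability under limits demands. *)
pose y_ (z : T') : R := (z : plane R).2 * \1_(core : set T') z.
have my : measurable_fun setT y_.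
  apply: (@measurable_fun_cvg _ T' R setT
    (fun m z => approx m 0 z * \1_(core : set T') z)).
    by move=> m; apply: measurable_funM.
  move=> z _; rewrite /y_ indicE; have [/set_mem cz|_] := boolP (z \in _).
    rewrite !mulr1.
    under eq_fun do rewrite mulr1.
    exact: approx_cvg.
  rewrite mulr0; under eq_fun do rewrite mulr0.
  exact: cvg_cst.
have mf : measurable_fun setT (fun z : T' => (past 0 z, y_ z) : plane R).
  exact: measurable_pair_plane.
have := mf measurableT _ mA; rewrite setTI measurable_sys /sys /=.
congr (<<s _, _ >> _); apply/seteqP; split=> z [cz]; rewrite /= /past /y_ /= indicE mem_set// mulr1;
  by case: z cz => x y cz Az; split.
Qed.

End Inverse.

Lemma core_generated (A : set (plane R)) : measurable A ->
  <<s core, past_sets >> (core `&` A).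
Proof.
have [_ _ Ss] := @core_bij R r hr.
have /choice[Sinv SinvP] : forall z, exists p, core z -> core p /\ S p = z.
  move=> z; have [cz|ncz] := pselect (core z); last by exists z.
  by have [p cp pz] := Ss _ cz; exists p.
exact: core_generated_of_inverse SinvP _.
Qed.

End Generation.

Section MassOne.
Context d (T : measurableType d) (R : realType).
Variables (m : {measure set T -> \bar R}) (m1 : m setT = 1%E).

(** A copy of [m] that carries the proof of total mass 1, to which the probability structure can be
    attached. *)
Definition mass_one_measure of m setT = 1%E : set T -> \bar R := m.

HB.instance Definition _ := Measure.on (mass_one_measure m1).
HB.instance Definition _ :=
  Measure_isProbability.Build _ _ _ (mass_one_measure m1) m1.

Lemma probability_of_mass_one : exists P : probability T R, forall A, P A = m A.
Proof. by exists (mass_one_measure m1 : probability T R). Qed.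

End MassOne.

(** * Assembling the natural extension *)

Section Assembly.
Context {R : realType} (r : nat) (hr : (3 <= r)%N).

Local Notation mu2 := (lebesgue2 R).
Local Notation alpha := (r%:R^-1 : R).
Local Notation S := (Tbar alpha : plane R -> plane R).
Local Notation DD := (D R r : set (plane R)).
Local Notation core := (@core R r : set (plane R)).

Lemma CalphaE : Calpha R r = kappa DD. Proof. by []. Qed.

Lemma kappa_setD_core (A : set (plane R)) : measurable A ->
  kappa (DD `&` A) = kappa (core `&` A).
Proof.
move=> mA; have mD := @measurable_D R r; have mc := measurable_core hr (R := R).
have mDc : measurable (DD `\` core) by exact: measurableD.
have -> : DD `&` A = (core `&` A) `|` ((DD `\` core) `&` A).
  rewrite -setIUl; congr (_ `&` _); apply/seteqP; split=> p.
    by have [?|?] := pselect (core p); [left|right].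
  by move=> [[]|[]].
rewrite measureU0//; [exact: measurableI|exact: measurableI|].
apply: (@kappa_sub_null _ _ (DD `\` core)) => //; first exact: measurableI.
by apply: kappa_null => //; exact: core_conull.
Qed.

Lemma kappa_preimage_Tbar (A : set (plane R)) : measurable A ->
  kappa (DD `&` S @^-1` A) = kappa (DD `&` A).
Proof.
move=> mA; have mc := measurable_core hr (R := R).
have mSA : measurable (S @^-1` A).
  by rewrite -[X in measurable X]setTI; exact: (measurable_Tbar r).
rewrite !kappa_setD_core//.
have [Sc Si Ss] := @core_bij R r hr.
have -> : core `&` A = S @` (core `&` S @^-1` A).
  apply/seteqP; split=> [z [cz Az]|_ [p [cp Ap] <-]]; last by split => //; exact: Sc.
  by have [p cp pz] := Ss _ cz; exists p => //; split => //=; rewrite pz.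
have mcA : measurable (core `&` S @^-1` A) by exact: measurableI.
have cX : core `&` S @^-1` A `<=` regular_source r by move=> p [/core_regular_source].
by have [_ ->] := image_Tbar hr mcA cX.
Qed.

Lemma Calpha_fin : exists2 c : R, 0 < c & Calpha R r = c%:E.
Proof.
have k0 := @kappa_D_gt0 R r hr; have ky := @kappa_D_lty R r hr.
exists (fine (kappa DD)); first by rewrite fine_gt0// k0 ky.
by rewrite CalphaE fineK// ge0_fin_numE.
Qed.

Lemma integral_Kalpha (A : set (plane R)) : measurable A ->
  (\int[mu2]_(p in A) (Kalpha r p)%:E = ((fine (Calpha R r))^-1)%:E * kappa A)%E.
Proof.
move=> mA; have [c c0 cE] := Calpha_fin.
rewrite kappaE -ge0_integralZl//.
- by apply/measurable_EFinP; apply: measurable_funTS; exact: measurable_kappa0.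
- by move=> p _; rewrite lee_fin kappa0_ge0.
- by rewrite lee_fin invr_ge0 cE /= ltW.
Qed.

Definition nu_density (p : plane R) : R := \1_DD p * Kalpha r p.

Lemma measurable_nu_density : measurable_fun setT nu_density.
Proof.
apply: measurable_funM; first exact: measurable_indic (measurable_D r).
by apply: measurable_funM => //; exact: measurable_kappa0.
Qed.

Lemma nu_density_ge0 p : 0 <= nu_density p.
Proof.
have [c c0 cE] := Calpha_fin.
by rewrite /nu_density /Kalpha !mulr_ge0 ?invr_ge0 ?sqr_ge0// cE ltW.
Qed.

Let nu0 : {measure set (plane R) -> \bar R} :=
  weighted_pushforward mu2 (@measurable_id _ _ setT)
    measurable_nu_density nu_density_ge0.

(** The invariant measure of [T_] is defined as the first marginal of [nu0], so its invariance is
    inherited through the projection. *)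
Let mu0 : {measure set (measurableTypeR R) -> \bar R} :=
  weighted_pushforward mu2
    (measurable_fst : measurable_fun [set: plane R] (fst : plane R -> measurableTypeR R))
    measurable_nu_density nu_density_ge0.

Let nu0E (A : set (plane R)) : measurable A ->
  nu0 A = (\int[mu2]_(p in DD `&` A) (Kalpha r p)%:E)%E.
Proof.
move=> mA; transitivity (\int[mu2]_(p in A) (nu_density p)%:E)%E; first by [].
rewrite [LHS]integral_mkcond [RHS]integral_mkcond; apply: eq_integral => p _.
rewrite /restrict in_setI; case: (p \in A); rewrite ?andbF// andbT.
by rewrite /nu_density indicE; case: (p \in DD); rewrite ?mul1r ?mul0r.
Qed.

Let nu0_kappa (A : set (plane R)) : measurable A ->
  nu0 A = (((fine (Calpha R r))^-1)%:E * kappa (DD `&` A))%E.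
Proof.
move=> mA; rewrite nu0E// integral_Kalpha//.
by apply: measurableI => //; exact: measurable_D.
Qed.

Let nu0_core : nu0 core = 1%E.
Proof.
have mc := measurable_core hr (R := R); have [c c0 cE] := Calpha_fin.
rewrite nu0_kappa// kappa_setD_core// setIid -[X in kappa X]setIT -kappa_setD_core//.
by rewrite setIT -CalphaE cE /= -EFinM mulVf// gt_eqF.
Qed.

Let nu0_T : nu0 setT = 1%E.
Proof.
have mc := measurable_core hr (R := R).
rewrite -nu0_core !nu0_kappa// kappa_setD_core// setIT.
by rewrite kappa_setD_core// setIid.
Qed.

Let nu0_Tbar (A : set (plane R)) : measurable A -> nu0 (S @^-1` A) = nu0 A.
Proof.
move=> mA; have mSA : measurable (S @^-1` A).
  by rewrite -[X in measurable X]setTI; exact: (measurable_Tbar r).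
by rewrite !nu0_kappa// kappa_preimage_Tbar.
Qed.

Lemma Tbar_natural_extension :
  exists (nu : probability (plane R) R) (mu : probability (measurableTypeR R) R),
    [/\ forall A : set (plane R), measurable A ->
          nu A = (\int[lebesgue2 R]_(p in D R r `&` A) (Kalpha r p)%:E)%E,
        mu (Ialpha alpha) = 1%E &
        natural_extension mu (T_ alpha) nu (Tbar alpha) fst].
Proof.
have mc := measurable_core hr (R := R).
have mfst : measurable_fun [set: plane R] (fst : plane R -> measurableTypeR R).
  exact: measurable_fst.
have mI : measurable (Ialpha alpha : set (measurableTypeR R)).
  exact: measurable_itv.
have mI2 : measurable (fst @^-1` (Ialpha alpha : set (measurableTypeR R)) : set (plane R)).
  by rewrite -[X in measurable X]setTI; exact: mfst.
have [nu nuE] := probability_of_mass_one nu0_T.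
have mu0_T : mu0 setT = 1%E by rewrite -nu0_T.
have [mu muE] := probability_of_mass_one mu0_T.
exists nu, mu; split.
- by move=> A mA; rewrite nuE nu0E.
- apply/eqP; rewrite eq_le probability_le1//= muE -nu0_core.
  change (mu0 (Ialpha alpha)) with (nu0 (fst @^-1` (Ialpha alpha))).
  apply: le_measure; rewrite ?inE// => p /core_regular_source/(regular_source_bounds hr)[+ _ _].
  by rewrite /in_dom /Ialpha /= in_itv/= => /andP[/ltW-> /ltW->].
split.
- split; first exact: measurable_T.
  move=> A mA; rewrite !muE.
  (* A conversion, since the first component of [Tbar] is [T_] of the first coordinate by
     definition. *)
  change (nu0 (S @^-1` (fst @^-1` A)) = nu0 (fst @^-1` A)); apply: nu0_Tbar.
  by rewrite -[X in measurable X]setTI; exact: mfst.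
- by split; [exact: measurable_Tbar|move=> A mA; rewrite !nuE nu0_Tbar].
- by split=> // A mA; rewrite muE nuE.
exists core; split.
- by rewrite nuE.
- exact: core_bij.
- move=> A mA Ac; have cX : A `<=` regular_source r by move=> p /Ac/core_regular_source.
  by have [] := image_Tbar hr mA cX.
- by [].
(* [A] and its trace on [core] differ only outside [core], a set of measure zero for [nu]. *)
move=> A mA; exists (core `&` A); first exact: core_generated.
exists (~` core); split.
- exact: measurableC.
- by rewrite probability_setC// nuE nu0_core subee.
move=> p; rewrite /= => + cp.
by move=> [[Ap []]|[[_ Ap] []]].
Qed.

End Assembly.

Unset Implicit Arguments.

Theorem theorem2 (R : realType) (r : nat) (hr : (3 <= r)%N) :
  let alpha : R := r%:R^-1 in
  [/\ measurable (D R r : set (plane R)),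
      (0 < Calpha R r < +oo)%E,
      (exists N : set (plane R),
         [/\ (lebesgue2 R).-negligible N,
             forall p, (D R r `\` N) p ->
               p.1 != 0 /\ (k_ alpha p.1)%:~R + Num.sg p.1 * p.2 != 0 &
             set_bij (D R r `\` N) (D R r `\` N) (Tbar alpha)]),
      (forall A : set (plane R), measurable A ->
         \int[lebesgue2 R]_(p in D R r `&` Tbar alpha @^-1` A)
           (Kalpha r p)%:E =
         \int[lebesgue2 R]_(p in D R r `&` A) (Kalpha r p)%:E)%E &
      exists (nu : probability (plane R) R)
             (mu : probability (measurableTypeR R) R),
        [/\ forall A : set (plane R), measurable A ->
              nu A = (\int[lebesgue2 R]_(p in D R r `&` A) (Kalpha r p)%:E)%E,
            mu (Ialpha alpha) = 1%E &
            natural_extension mu (T_ alpha) nu (Tbar alpha) fst]].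
Proof.
move=> alpha; have mD := @measurable_D R r; have mc := measurable_core hr (R := R).
split=> //.
- by rewrite CalphaE kappa_D_gt0//= kappa_D_lty.
- exists (D R r `\` core r).
  have -> : D R r `\` (D R r `\` core r) = core r.
    by rewrite setDD setIidr//; move=> p [].
  split; last exact: core_bij.
    exists (D R r `\` core r); split => //; first exact: measurableD.
    exact: core_conull.
  move=> p cp; have X1p := core_regular_source cp; have [_ ip _ _ _] := X1p.
  split.
    by apply/eqP => pE; apply: (irrational_neq (q := 0) ip); rewrite rmorph0.
  have [_ /andP[p0 p1] _] := regular_source_bounds hr X1p.
  have p01 : 0 <= (p.2 : R) <= 1 by rewrite !ltW.
  by rewrite gt_eqF// (lt_le_trans ltr01)//; exact: branch_denom_ge1.
- move=> A mA; have mSA : measurable (Tbar alpha @^-1` A : set (plane R)).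
    by rewrite -[X in measurable X]setTI; exact: (measurable_Tbar r).
  by rewrite !integral_Kalpha//; try exact: measurableI; rewrite kappa_preimage_Tbar.
- exact: Tbar_natural_extension.
Qed.
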